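(* Let $3\le r\le p\le q$ be integers with $\frac1r+\frac1p+\frac1q<1$, and let $$l_1=2\,\mathrm{arccosh}\Big(2\cos\tfrac{\pi}{p}\cos\tfrac{\pi}{r}+\cos\tfrac{\pi}{q}\Big),\quad l_2=2\,\mathrm{arccosh}\Big(2\cos\tfrac{\pi}{q}\cos\tfrac{\pi}{r}+\cos\tfrac{\pi}{p}\Big),\quad l_3=2\,\mathrm{arccosh}\Big(2\cos\tfrac{\pi}{p}\cos\tfrac{\pi}{q}+\cos\tfrac{\pi}{r}\Big).$$ Let $\lambda_1\le\lambda_2\le\lambda_3\le\cdots$ be the length spectrum of the triangle group $\Gamma(r,p,q)$, listed in nondecreasing order with multiplicity. Then: (i) if $(r,p)=(3,3)$ and $q\ge4$, then $\lambda_1=\lambda_2=l_1$; (ii) if $(r,p,q)=(3,4,4)$, then $\lambda_1=\lambda_2=l_1$; (iii) if $r=3$, $p\ge4$ and $q\ge5$, then $\lambda_1=\lambda_2=l_1<\lambda_3=l_3$; (iv) if $r\ge4$, then $\lambda_1=\lambda_2=l_1\le\lambda_3=\lambda_4=l_2\le\lambda_5=l_3$, where moreover $l_1=l_2$ if and only if $p=q$, and $l_2=l_3$ if and only if $r=p$.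
   Context: Let $\mathbf H$ be the hyperbolic plane with its distance $d$. For integers $r\le p\le q$ with $1/r+1/p+1/q<1$, let $T$ be a hyperbolic triangle with angles $\pi/r,\pi/p,\pi/q$; $\Gamma_0(r,p,q)$ is the group generated by the reflections in the sides of $T$, and the triangle group $\Gamma(r,p,q)$ is its subgroup of orientation-preserving elements. For a hyperbolic element $\gamma\in\Gamma(r,p,q)$ its length is $l(\gamma)=\inf\{d(x,\gamma x): x\in\mathbf H\}$. The length spectrum $\mathrm{Lsp}\,\Gamma(r,p,q)$ is the family of the numbers $l(\gamma)$ as $\gamma$ runs over the $\Gamma(r,p,q)$-conjugacy classes of hyperbolic elements of $\Gamma(r,p,q)$, listed in nondecreasing order with multiplicity (each conjugacy class contributes one entry; in particular $\gamma$ and $\gamma^{-1}$ contribute separately if they are not conjugate in $\Gamma(r,p,q)$). *)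

(* Defs.v *)
From HB Require Import structures.
From mathcomp Require Import all_boot all_order all_algebra.
From mathcomp Require Import all_classical all_reals all_analysis.

Set Implicit Arguments.
Unset Strict Implicit.
Unset Printing Implicit Defensive.

Import Order.TTheory GRing.Theory Num.Theory.
Local Open Scope classical_set_scope.
Local Open Scope ring_scope.

Definition arccosh {R : realType} (x : R) : R := ln (x + Num.sqrt (x ^+ 2 - 1)).

(* The hyperbolic plane is the upper sheet of the hyperboloid <u, u> = -1 in
   Minkowski space R^{2,1}, coordinate 0 being the timelike one.  Isometries of
   the plane are the restrictions of the Lorentz matrices preserving that sheet,
   so they are represented by these 3 x 3 matrices, acting on column vectors. *)

Definition lorentz_mx (R : realType) : 'M[R]_3 :=
  diag_mx (\row_j (if j == 0 then -1 else 1)).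

Definition ldot {R : realType} (u v : 'cV[R]_3) : R :=
  (u^T *m lorentz_mx R *m v) 0 0.

Definition hplane {R : realType} : set 'cV[R]_3 :=
  [set u | ldot u u = -1 /\ 0 < u 0 0].

Definition hdist {R : realType} (u v : 'cV[R]_3) : R := arccosh (- ldot u v).

(* A geodesic line is the trace on the plane of the Lorentz-orthogonal of a
   spacelike vector n. *)
Definition spacelike {R : realType} (n : 'cV[R]_3) : Prop := 0 < ldot n n.

Definition hline {R : realType} (n : 'cV[R]_3) : set 'cV[R]_3 :=
  [set u | hplane u /\ ldot n u = 0].

(* The reflection u |-> u - 2 (<n, u> / <n, n>) n in the line hline n. *)
Definition hrefl {R : realType} (n : 'cV[R]_3) : 'M[R]_3 :=
  1 - (2 / ldot n n) *: (n *m n^T *m lorentz_mx R).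

Lemma hreflE (R : realType) (n u : 'cV[R]_3) :
  hrefl n *m u = u - (2 * ldot n u / ldot n n) *: n.
Proof.
rewrite mulmxBl mul1mx -scalemxAl -!mulmxA; congr (_ - _).
have -> : n^T *m (lorentz_mx R *m u) = (ldot n u)%:M.
  by rewrite mulmxA [LHS]mx11_scalar.
by rewrite mul_mx_scalar scalerA mulrAC.
Qed.

(* Initial vector at a of the geodesic from a to b, up to a positive factor:
   the projection of b to the tangent plane of the hyperboloid at a. *)
Definition tangent {R : realType} (a b : 'cV[R]_3) : 'cV[R]_3 :=
  b + ldot a b *: a.

(* Angle at the vertex a between the geodesic segments from a to b and c. *)
Definition hangle {R : realType} (a b c : 'cV[R]_3) : R :=
  let u := tangent a b in let v := tangent a c in
  acos (ldot u v / (Num.sqrt (ldot u u) * Num.sqrt (ldot v v))).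

(* Nondegenerate triangles; equal vertices are excluded since two points always
   lie on a common line. *)
Definition htriangle {R : realType} (a b c : 'cV[R]_3) : Prop :=
  [/\ hplane a, hplane b, hplane c &
      ~ exists n, [/\ spacelike n, hline n a, hline n b & hline n c]].

Definition reflections_in {R : realType} (a b : 'cV[R]_3) : set 'M[R]_3 :=
  [set g | exists n, [/\ spacelike n, hline n a, hline n b & g = hrefl n]].

Inductive generated {M : unitRingType} (S : set M) : set M :=
| generated_in g : S g -> generated S g
| generated_1 : generated S 1
| generated_mul g h : generated S g -> generated S h -> generated S (g * h)
| generated_inv g : generated S g -> generated S g^-1.

Definition reflection_group {R : realType} (a b c : 'cV[R]_3) : set 'M[R]_3 :=
  generated (reflections_in a b `|` reflections_in b c `|` reflections_in c a).

(* A Lorentz matrix preserving the upper sheet preserves the orientation of the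
   hyperbolic plane iff its determinant is positive. *)
Definition triangle_group {R : realType} (a b c : 'cV[R]_3) : set 'M[R]_3 :=
  [set g | reflection_group a b c g /\ 0 < \det g].

(* Isometries whose displacement function attains a positive minimum. *)
Definition hyperbolic {R : realType} (g : 'M[R]_3) : Prop :=
  exists u, [/\ hplane u, 0 < hdist u (g *m u) &
    forall v, hplane v -> hdist u (g *m u) <= hdist v (g *m v)].

Definition hlength {R : realType} (g : 'M[R]_3) : R :=
  inf [set hdist u (g *m u) | u in hplane].

Definition conj_class {M : unitRingType} (G : set M) (g : M) : set M :=
  [set k * g * k^-1 | k in G].

Definition hyperbolic_classes {R : realType} (G : set 'M[R]_3) :
    set (set 'M[R]_3) :=
  [set conj_class G g | g in [set g | G g /\ hyperbolic g]].

(* lam lists the lengths of the hyperbolic conjugacy classes of G in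
   nondecreasing order, one entry per class; the first entry is lam 0. *)
Definition length_spectrum {R : realType} (G : set 'M[R]_3) (lam : nat -> R) :
    Prop :=
  nondecreasing_seq lam /\
  exists2 cls : nat -> set 'M[R]_3,
    set_bij [set: nat] (hyperbolic_classes G) cls &
    forall k g, cls k g -> lam k = hlength g.

(* Main.v *)
Require Import Defs.
From HB Require Import structures.
From mathcomp Require Import all_boot all_order all_algebra.
From mathcomp Require Import all_classical all_reals all_analysis.
From mathcomp Require Import ring lra zify.

Set Implicit Arguments.
Unset Strict Implicit.
Unset Printing Implicit Defensive.

Import Order.TTheory GRing.Theory Num.Theory.
Local Open Scope classical_set_scope.
Local Open Scope ring_scope.

(** Billiards in the triangle drive the proof.  The letters 0, 1, 2 stand for
   the sides opposite to a, b, c, with outward unit normals n_0, n_1, n_2, so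
   that <n_i, n_j> = - cos (pi / m_ij), where m_12 = r, m_02 = p, m_01 = q; the
   group generated by the reflections in the sides consists of the products
   of reflections along words in these letters.

   Length bound.  A geodesic from a point x of the triangle T to its image g x
   folds up to a billiard path in T whose bounces spell a word of g (lemma
   gallery), so the length of g is bounded below by the length of a closed
   polygon with vertices on the corresponding side lines.  Dropping vertices
   only shortens the polygon, and a closed polygon that touches the lines 0, 1,
   0, 2 in this cyclic order has length at least l3, because after reflection
   in line 0 it joins line 1 to the mirror image of line 2 twice (polygon_len).
   If a word does not contain 0, 1, 0, 2 as a cyclic subsequence, then all its
   letters 1 and 2 lie between two consecutive letters 0, so it is conjugate to
   a word that misses a letter, which fixes a vertex of T, or to 0 b with b a
   word in 1 and 2 (word_cases).  In the latter case b is a reflection of the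
   dihedral group at the vertex of angle pi / r, and the length of 0 b is
   explicit: it is l1 or l2 for the two words 0 2 1 2 and 0 1 2 1, and at least
   l3 for the others (dichotomy).  Hence only the classes of these two
   translations and of their inverses can be shorter than l3.

   Multiplicities.  Such a translation is the product of the reflections in
   two disjoint lines, and its axis is their common perpendicular.  If w maps
   the axis of one translation to that of another, choose a point b of the
   second axis inside T.  A suitable element d of the group that preserves the
   first axis brings w^-1 b into T or into one neighbour of T (axis_transport), so that d w^-1 is the identity or one
   reflection.  It follows that a translation is conjugate to its inverse only
   by orientation reversing elements (transl_not_conj_inv), and that different
   translations are not conjugate as soon as r >= 4 (transl_not_conj); for
   r = 3 the braid relation makes the two short translations equal.

   Both parts need that T is a fundamental domain.  This rests on the theorem
   of Tits that a reflection lengthens a word exactly when the corresponding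
   root is a nonnegative combination of the n_i (tits); that the translates
   of T cover the plane follows from the growth of distances with word length
   (covering). *)

(** * Minkowski space *)

Section Minkowski.
Variable R : realType.
Implicit Types (u v x y z n : 'cV[R]_3) (a : R) (g : 'M[R]_3).

Lemma sum3 (V : nmodType) (F : 'I_3 -> V) : \sum_i F i = F 0 + F 1 + F 2%R.
Proof.
rewrite !big_ord_recl big_ord0 addr0 addrA.
by congr (F _ + F _ + F _); apply: val_inj.
Qed.

Lemma all3 (P : 'I_3 -> Prop) : P 0 -> P 1 -> P 2%R -> forall i, P i.
Proof.
move=> P0 P1 P2 i.
by case: i => [[|[|[|//]]] /= ilt]; [rewrite (_ : Ordinal ilt = 0) | rewrite (_ : Ordinal ilt = 1)
  | rewrite (_ : Ordinal ilt = 2%R)] => //; apply: val_inj.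
Qed.

Lemma cV3P u v : u 0 0 = v 0 0 -> u 1 0 = v 1 0 -> u 2%R 0 = v 2%R 0 -> u = v.
Proof. by move=> e0 e1 e2; apply/colP; apply: all3. Qed.

Lemma ldotE u v : ldot u v = - (u 0 0 * v 0 0) + u 1 0 * v 1 0 + u 2%R 0 * v 2%R 0.
Proof.
rewrite /ldot /lorentz_mx mul_mx_diag !mxE sum3 !mxE /=; ring.
Qed.

Lemma ldotC u v : ldot u v = ldot v u.
Proof. by rewrite !ldotE; ring. Qed.
Lemma ldotDl u v w : ldot (u + v) w = ldot u w + ldot v w.
Proof. by rewrite !ldotE !mxE; ring. Qed.
Lemma ldotZl a u v : ldot (a *: u) v = a * ldot u v.
Proof. by rewrite !ldotE !mxE; ring. Qed.
Lemma ldotNl u v : ldot (- u) v = - ldot u v.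
Proof. by rewrite !ldotE !mxE; ring. Qed.
Lemma ldotDr u v w : ldot u (v + w) = ldot u v + ldot u w.
Proof. by rewrite ldotC ldotDl !(ldotC u). Qed.
Lemma ldotZr a u v : ldot u (a *: v) = a * ldot u v.
Proof. by rewrite ldotC ldotZl (ldotC u). Qed.
Lemma ldotNr u v : ldot u (- v) = - ldot u v.
Proof. by rewrite ldotC ldotNl (ldotC u). Qed.

Definition ldotS := (ldotDl, ldotDr, ldotNl, ldotNr, ldotZl, ldotZr).

Definition det3 x y z : R :=
  x 0 0 * (y 1 0 * z 2%R 0 - y 2%R 0 * z 1 0)
  - x 1 0 * (y 0 0 * z 2%R 0 - y 2%R 0 * z 0 0)
  + x 2%R 0 * (y 0 0 * z 1 0 - y 1 0 * z 0 0).

(** The sign comes from the determinant -1 of the Lorentz form; the triangle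
   inequality and all bounds on distances to lines are instances. *)
Lemma gram3 x y z :
  ldot x x * ldot y y * ldot z z + 2 * ldot x y * ldot y z * ldot x z
  - ldot x x * ldot y z ^+ 2 - ldot y y * ldot x z ^+ 2 - ldot z z * ldot x y ^+ 2
  = - det3 x y z ^+ 2.
Proof. by rewrite /det3 !ldotE; ring. Qed.

Lemma gram3_le0 x y z :
  ldot x x * ldot y y * ldot z z + 2 * ldot x y * ldot y z * ldot x z
  - ldot x x * ldot y z ^+ 2 - ldot y y * ldot x z ^+ 2 - ldot z z * ldot x y ^+ 2 <= 0.
Proof. by rewrite gram3 oppr_le0 sqr_ge0. Qed.

Lemma hplane_ldot u v : hplane u -> hplane v -> ldot u v <= -1.
Proof.
move=> [uu u0] [vv v0]; rewrite -(opprK (ldot u v)) lerN2.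
set X := - ldot u v.
move: uu vv; rewrite !ldotE => uu vv.
have X0 : 0 < u 0 0 * v 0 0 by rewrite mulr_gt0.
set p := u 1 0 * v 1 0 + u 2%R 0 * v 2%R 0.
have -> : X = u 0 0 * v 0 0 - p by rewrite /X /p ldotE; ring.
have h : p ^+ 2 <= (u 0 0 * v 0 0 - 1) ^+ 2.
  have e : (u 0 0 ^+2 - 1) * (v 0 0 ^+ 2 - 1) - p ^+ 2 =
    (u 1 0 * v 2%R 0 - u 2%R 0 * v 1 0) ^+ 2.
    have -> : u 0 0 ^+2 - 1 = u 1 0 ^+ 2 + u 2%R 0 ^+ 2 by lra.
    have -> : v 0 0 ^+2 - 1 = v 1 0 ^+ 2 + v 2%R 0 ^+ 2 by lra.
    by rewrite /p; ring.
  have := sqr_ge0 (u 1 0 * v 2%R 0 - u 2%R 0 * v 1 0); rewrite -e.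
  have := sqr_ge0 (u 0 0 - v 0 0); nra.
have h1 : 1 <= u 0 0 * v 0 0.
  have : 1 <= u 0 0 by nra.
  have : 1 <= v 0 0 by nra.
  nra.
have : p <= u 0 0 * v 0 0 - 1; last lra.
by case: (leP p (u 0 0 * v 0 0 - 1)) => // h2; nra.
Qed.

Lemma hplane_timelike u v : hplane u -> ldot v v = -1 -> ldot u v < 0 -> hplane v.
Proof.
move=> hu vv uv; split=> //.
have v0 : v 0 0 != 0.
  apply/eqP => v0; move: vv; rewrite ldotE v0.
  have := sqr_ge0 (v 1 0); have := sqr_ge0 (v 2%R 0); nra.
case: ltgtP v0 => // v0 _.
have hv : hplane (- v).
  by split; [rewrite ldotNl ldotNr opprK | rewrite mxE oppr_gt0].
by have := hplane_ldot hu hv; rewrite ldotNr; lra.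
Qed.

Lemma hrefl1E n u : ldot n n = 1 -> hrefl n *m u = u - (2 * ldot n u) *: n.
Proof. by move=> nn; rewrite hreflE nn divr1. Qed.

Lemma hreflK n u : ldot n n = 1 -> hrefl n *m (hrefl n *m u) = u.
Proof.
move=> nn; rewrite !hrefl1E // ldotDr ldotNr ldotZr nn -addrA -opprD -scalerDl.
have -> : 2 * ldot n u + 2 * (ldot n u - 2 * ldot n u * 1) = 0 by ring.
by rewrite scale0r subr0.
Qed.

Lemma mx_ext (A B : 'M[R]_3) : (forall u, A *m u = B *m u) -> A = B.
Proof.
move=> AB; apply/matrixP => i j.
by have /colP/(_ i) := AB (delta_mx j 0); rewrite -!colE !mxE.
Qed.

Lemma hrefl_sqr n : ldot n n = 1 -> hrefl n * hrefl n = 1.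
Proof.
by move=> nn; apply: mx_ext => u; rewrite -mulmxA hreflK // mul1mx.
Qed.

Lemma hrefl_adj n u v : ldot n n = 1 -> ldot (hrefl n *m u) v = ldot u (hrefl n *m v).
Proof.
move=> nn; rewrite !hrefl1E // !ldotS (ldotC n v) (ldotC n u); ring.
Qed.

Lemma hrefl_isom n u v : ldot n n = 1 -> ldot (hrefl n *m u) (hrefl n *m v) = ldot u v.
Proof. by move=> nn; rewrite hrefl_adj // hreflK. Qed.

Lemma hrefl_hplane n u : ldot n n = 1 -> hplane u -> hplane (hrefl n *m u).
Proof.
move=> nn hu; apply: (hplane_timelike hu); first by rewrite hrefl_isom // (proj1 hu).
rewrite hrefl1E // !ldotS (proj1 hu) (ldotC u n).
have := sqr_ge0 (ldot n u); nra.
Qed.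

Lemma hrefl_fix n u : ldot n n = 1 -> ldot n u = 0 -> hrefl n *m u = u.
Proof. by move=> nn nu; rewrite hrefl1E // nu mulr0 scale0r subr0. Qed.

Lemma det_mx33 (M : 'M[R]_3) : \det M =
  M 0 0 * (M 1 1 * M 2%R 2%R - M 1 2%R * M 2%R 1)
  - M 0 1 * (M 1 0 * M 2%R 2%R - M 1 2%R * M 2%R 0)
  + M 0 2%R * (M 1 0 * M 2%R 1 - M 1 1 * M 2%R 0).
Proof.
have det22 (A : 'M[R]_2) : \det A = A 0 0 * A 1 1 - A 0 1 * A 1 0.
  rewrite (expand_det_row _ 0) !big_ord_recl big_ord0 /cofactor !det_mx11 !mxE /=.
  have -> : lift 0 0 = 1 :> 'I_2 by apply: val_inj.
  have -> : lift 1 0 = 0 :> 'I_2 by apply: val_inj.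
  by rewrite /= !expr1 expr0; ring.
rewrite (expand_det_row _ 0) sum3 /cofactor !det22 !mxE /=.
have -> : lift 0 0 = 1 :> 'I_3 by apply: val_inj.
have -> : lift 0 1 = 2%R :> 'I_3 by apply: val_inj.
have -> : lift 1 0 = 0 :> 'I_3 by apply: val_inj.
have -> : lift 1 1 = 2%R :> 'I_3 by apply: val_inj.
have -> : lift 2%R 0 = 0 :> 'I_3 by apply: val_inj.
have -> : lift 2%R 1 = 1 :> 'I_3 by apply: val_inj.
by rewrite /= !modn_small //=; ring.
Qed.

Lemma det_hrefl n : ldot n n = 1 -> \det (hrefl n) = -1.
Proof.
move=> nn.
have E i j : hrefl n i j = (i == j)%:R - 2 * n i 0 * (if j == 0 then - n j 0 else n j 0).
  rewrite /hrefl nn divr1 /lorentz_mx mul_mx_diag !mxE big_ord1 !mxE.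
  by case: (j =P 0) => [->|_]; ring.
move: nn; rewrite ldotE => nn.
rewrite det_mx33 !E /=.
transitivity (1 - 2 * (- (n 0 0 * n 0 0) + n 1 0 * n 1 0 + n 2%R 0 * n 2%R 0)); last by rewrite nn; ring.
by ring.
Qed.

End Minkowski.

(** * Hyperbolic distance *)
Section Distance.
Variable R : realType.
Implicit Types (u v x y z n : 'cV[R]_3) (a A B C X : R).

Lemma sqrB1_ge0 X : 1 <= X -> 0 <= X ^+ 2 - 1.
Proof. by move=> X1; rewrite subr_ge0 exprn_ege1. Qed.

Lemma arccosh_arg_ge1 X : 1 <= X -> 1 <= X + Num.sqrt (X ^+ 2 - 1).
Proof. by move=> X1; have := sqrtr_ge0 (X ^+ 2 - 1); lra. Qed.

Lemma arccosh1 : arccosh 1 = 0 :> R.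
Proof. by rewrite /arccosh expr1n subrr sqrtr0 addr0 ln1. Qed.

Lemma ltr_arccosh X B : 1 <= X -> X < B -> arccosh X < arccosh B.
Proof.
move=> X1 XB; have B1 : 1 <= B by lra.
rewrite /arccosh ltr_ln ?posrE; last 2 first.
- by have := arccosh_arg_ge1 X1; lra.
- by have := arccosh_arg_ge1 B1; lra.
apply: ltr_leD => //; apply: ler_wsqrtr.
rewrite lerB // ler_pXn2r // ?nnegrE; lra.
Qed.

Lemma ler_arccosh X B : 1 <= X -> X <= B -> arccosh X <= arccosh B.
Proof.
move=> X1; rewrite le_eqVlt => /orP[/eqP->//|XB].
exact/ltW/ltr_arccosh.
Qed.

Lemma arccosh_inj X B : 1 <= X -> 1 <= B -> arccosh X = arccosh B -> X = B.
Proof.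
move=> X1 B1 e; case: (ltgtP X B) => // h.
- by have := ltr_arccosh X1 h; rewrite e ltxx.
- by have := ltr_arccosh B1 h; rewrite e ltxx.
Qed.

(** This is cosh (s + t) = cosh s cosh t + sinh s sinh t. *)
Lemma arccoshD A B : 1 <= A -> 1 <= B ->
  arccosh A + arccosh B =
  arccosh (A * B + Num.sqrt (A ^+ 2 - 1) * Num.sqrt (B ^+ 2 - 1)).
Proof.
move=> A1 B1.
have eA : Num.sqrt (A ^+ 2 - 1) ^+ 2 = A ^+ 2 - 1 by rewrite sqr_sqrtr // sqrB1_ge0.
have eB : Num.sqrt (B ^+ 2 - 1) ^+ 2 = B ^+ 2 - 1 by rewrite sqr_sqrtr // sqrB1_ge0.
have sA := sqrtr_ge0 (A ^+ 2 - 1); have sB := sqrtr_ge0 (B ^+ 2 - 1).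
rewrite /arccosh -lnM ?posrE; last 2 first.
- by have := arccosh_arg_ge1 A1; lra.
- by have := arccosh_arg_ge1 B1; lra.
congr ln.
set sa := Num.sqrt (A ^+ 2 - 1) in eA sA *; set sb := Num.sqrt (B ^+ 2 - 1) in eB sB *.
have -> : (A * B + sa * sb) ^+ 2 - 1 = (A * sb + B * sa) ^+ 2.
  apply/eqP; rewrite -subr_eq0; apply/eqP.
  transitivity ((A ^+ 2 - sa ^+ 2) * (B ^+ 2 - sb ^+ 2) - 1); first by ring.
  by rewrite eA eB; ring.
rewrite sqrtr_sqr ger0_norm; first by ring.
by rewrite addr_ge0 // mulr_ge0 //; lra.
Qed.

Lemma arccosh2 C : 1 <= C -> 2 * arccosh C = arccosh (2 * C ^+ 2 - 1).
Proof.
move=> C1; rewrite mulr_natl mulr2n arccoshD // -(expr2 (Num.sqrt _)) sqr_sqrtr ?sqrB1_ge0 //.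
by congr arccosh; ring.
Qed.

Lemma hdistC u v : hdist u v = hdist v u.
Proof. by rewrite /hdist ldotC. Qed.

Lemma hdist_refl u : hplane u -> hdist u u = 0.
Proof. by move=> [uu _]; rewrite /hdist uu opprK arccosh1. Qed.

(** With A, B, X the hyperbolic cosines of the three distances, the Gram bound
   reads (X - A B)^2 <= (A^2 - 1) (B^2 - 1), that is, X is at most the
   hyperbolic cosine of the sum of the first two distances. *)
Lemma hdist_triangle v u w : hplane u -> hplane v -> hplane w ->
  hdist u w <= hdist u v + hdist v w.
Proof.
move=> hu hv hw; rewrite /hdist.
have := hplane_ldot hu hv; have := hplane_ldot hv hw; have := hplane_ldot hu hw.
have := gram3_le0 u v w; rewrite (proj1 hu) (proj1 hv) (proj1 hw).
move: (ldot u v) (ldot v w) (ldot u w) => a b x G x1 b1 a1.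
have A1 : 1 <= - a by lra.
have B1 : 1 <= - b by lra.
have X1 : 1 <= - x by lra.
rewrite arccoshD //; apply: ler_arccosh => //.
rewrite -lerBlDl; apply: le_trans (ler_norm _) _.
rewrite -sqrtr_sqr -sqrtrM ?sqrB1_ge0 //.
apply: ler_wsqrtr; rewrite -subr_ge0; rewrite -oppr_ge0 in G; move: G.
by congr (0 <= _); ring.
Qed.

Lemma hdist_segment a b x z :
  hplane x -> hplane z -> 0 <= a -> 0 <= b -> hplane (a *: x + b *: z) ->
  hdist x z = hdist x (a *: x + b *: z) + hdist (a *: x + b *: z) z.
Proof.
move=> hx hz a0 b0 hq; have hxq := hplane_ldot hx hq; have hqz := hplane_ldot hq hz.
have X1 := hplane_ldot hx hz.
move: (proj1 hq) hxq hqz; rewrite /hdist !ldotS (proj1 hx) (proj1 hz) (ldotC z x).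
set X := - ldot x z; have -> : ldot x z = - X by rewrite /X opprK.
have {}X1 : 1 <= X by rewrite /X; lra.
move=> e hA hB; rewrite arccoshD; try lra.
have eA : (- (a * -1 + b * - X)) ^+ 2 - 1 = b ^+ 2 * (X ^+ 2 - 1).
  transitivity ((a + b * X) ^+ 2 - (a ^+ 2 + b ^+ 2 + 2 * a * b * X)); last by ring.
  by congr (_ - _); [ring | lra].
have eB : (- (a * - X + b * -1)) ^+ 2 - 1 = a ^+ 2 * (X ^+ 2 - 1).
  transitivity ((b + a * X) ^+ 2 - (a ^+ 2 + b ^+ 2 + 2 * a * b * X)); last by ring.
  by congr (_ - _); [ring | lra].
rewrite eA eB (sqrtrM _ (sqr_ge0 b)) (sqrtrM _ (sqr_ge0 a)) !sqrtr_sqr !ger0_norm //.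
have -> : b * Num.sqrt (X ^+ 2 - 1) * (a * Num.sqrt (X ^+ 2 - 1)) =
   a * b * (X ^+ 2 - 1).
  by rewrite mulrACA -expr2 sqr_sqrtr ?sqrB1_ge0 //; ring.
congr arccosh.
transitivity (X * (a ^+ 2 + b ^+ 2 + 2 * a * b * X)); last by ring.
have -> : a ^+ 2 + b ^+ 2 + 2 * a * b * X = 1 by lra.
by rewrite mulr1.
Qed.

Lemma hplane_normalize a b x z :
  hplane x -> hplane z -> 0 <= a -> 0 <= b -> 0 < a + b ->
  exists2 k, 0 < k & hplane ((k * a) *: x + (k * b) *: z).
Proof.
move=> hx hz a0 b0 ab; have X1 := hplane_ldot hx hz.
pose N := a ^+ 2 + b ^+ 2 - 2 * a * b * ldot x z.
have N0 : 0 < N.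
  have ab0 : 0 <= a * b by rewrite mulr_ge0.
  have : 0 <= a * b * (- 1 - ldot x z) by rewrite mulr_ge0 // subr_ge0.
  move=> h; have : (a + b) ^+ 2 <= N by rewrite /N; lra.
  by apply: lt_le_trans; rewrite exprn_gt0.
pose k := (Num.sqrt N)^-1.
have k0 : 0 < k by rewrite invr_gt0 sqrtr_gt0.
exists k => //; split.
  rewrite !ldotS (proj1 hx) (proj1 hz) (ldotC z x).
  transitivity (- (k ^+ 2 * N)); first by rewrite /N; ring.
  by rewrite /k exprVn sqr_sqrtr ?(ltW N0) // mulVf // gt_eqF.
rewrite !mxE -!mulrA -mulrDr mulr_gt0 //.
have x0 := proj2 hx; have z0 := proj2 hz.
have [a0'|a0'] := ltP 0 a.
  by rewrite ltr_pwDl ?mulr_ge0 ?mulr_gt0 // ltW.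
have b0' : 0 < b by lra.
by rewrite ltr_wpDl ?mulr_ge0 ?mulr_gt0 // ltW.
Qed.

Lemma hdist_hrefl n u v : ldot n n = 1 ->
  hdist (hrefl n *m u) (hrefl n *m v) = hdist u v.
Proof. by move=> nn; rewrite /hdist hrefl_isom. Qed.

End Distance.

(** * Chebyshev polynomials of the second kind *)
Section Chebyshev.
Variable R : realType.
Implicit Types (t : R) (m k : nat).

(** The value U_(k-1)(cos t): for t = pi / m these numbers are the coefficients
   of the roots of a dihedral group of order 2m in its simple roots. *)
Definition cheb t k : R := sin (k%:R * t) / sin t.

Lemma cheb0 t : cheb t 0 = 0.
Proof. by rewrite /cheb mul0r sin0 mul0r. Qed.

Lemma cheb1 t : sin t != 0 -> cheb t 1 = 1.
Proof. by move=> t0; rewrite /cheb mul1r divff. Qed.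

Lemma chebSS t k : cheb t k.+2 = 2 * cos t * cheb t k.+1 - cheb t k.
Proof.
rewrite /cheb mulrA -mulrBl; congr (_ / _).
have e2 : k.+2%:R * t = k.+1%:R * t + t by rewrite -!natr1; ring.
have e0 : k%:R * t = k.+1%:R * t - t by rewrite -natr1; ring.
by rewrite e2 e0 sinD sinB; ring.
Qed.

Lemma sin_piM_gt0 m : (2 <= m)%N -> 0 < sin (pi / m%:R :> R).
Proof.
move=> m2; have m0 : 0 < m%:R :> R by rewrite ltr0n; apply: leq_trans m2.
apply: sin_gt0_pi; rewrite divr_gt0 ?pi_gt0 //= ltr_pdivrMr // ltr_pMr ?pi_gt0 //.
by rewrite ltr1n.
Qed.

Lemma cheb_ge0 m k : (2 <= m)%N -> (k <= m)%N -> 0 <= cheb (pi / m%:R) k.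
Proof.
move=> m2 km; have m0 : 0 < m%:R :> R by rewrite ltr0n; apply: leq_trans m2.
rewrite /cheb divr_ge0 ?(ltW (sin_piM_gt0 m2)) //; apply: sin_ge0_pi.
rewrite mulr_ge0 ?divr_ge0 ?pi_ge0 ?ler0n //=.
by rewrite mulrCA ger_pMr ?pi_gt0 // ler_pdivrMr // mul1r ler_nat.
Qed.

Lemma cheb_sym m k : (2 <= m)%N -> (k <= m)%N ->
  cheb (pi / m%:R) (m - k) = cheb (pi / m%:R) k.
Proof.
move=> m2 km; have m0 : m%:R != 0 :> R by rewrite pnatr_eq0; case: m m2 {km}.
rewrite /cheb; congr (_ / _); rewrite natrB // mulrBl mulrCA divff // mulr1.
by rewrite sinB cospi sinpi; ring.
Qed.

(** The symmetry k |-> m - k reduces to k <= m / 2, where the sine increases. *)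
Lemma cheb_unimodal m a k : (2 <= m)%N -> (a <= k)%N -> (k + a <= m)%N ->
  cheb (pi / m%:R) a <= cheb (pi / m%:R) k.
Proof.
move=> m2.
wlog k2 : k / (k.*2 <= m)%N.
  move=> H ak kam; case: (leqP k.*2 m) => [|mk]; first by move=> h; apply: H.
  by rewrite -(@cheb_sym m k) //; [apply: H | ]; lia.
move=> ak _; rewrite /cheb ler_pM2r ?invr_gt0 ?sin_piM_gt0 //.
have m0 : 0 < m%:R :> R by rewrite ltr0n; apply: leq_trans m2.
have le2 j : (j <= k)%N -> j%:R * (pi / m%:R) \in `[ (- (pi / 2)), pi / 2 : R].
  move=> jk; rewrite in_itv /= (@le_trans _ _ 0) ?oppr_le0 ?divr_ge0 ?pi_ge0 //=; last first.
    by rewrite mulr_ge0 ?divr_ge0 ?pi_ge0.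
  rewrite mulrCA ler_pM2l ?pi_gt0 // ler_pdivrMr // mulrC ler_pdivlMr // -natrM ler_nat.
  by lia.
rewrite leNgt ltr_sin ?le2 // -leNgt ler_pM2r ?ler_nat //.
by rewrite divr_gt0 // pi_gt0.
Qed.

End Chebyshev.

(** * Words in the reflections *)

(** A triangle with angles pi / m: the outward unit normals of its sides and
   the vertex opposite to each side.  The vertices are kept because, up to
   positive factors, they form the basis dual to the normals. *)
Record mirrors (R : realType) := Mirrors {
  side : 'I_3 -> 'cV[R]_3;
  vert : 'I_3 -> 'cV[R]_3;
  ord : 'I_3 -> 'I_3 -> nat;
  side_unit : forall i, ldot (side i) (side i) = 1;
  side_angle : forall i j, i != j ->
    ldot (side i) (side j) = - cos (pi / (ord i j)%:R);
  ordC : forall i j, ord i j = ord j i;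
  ord_ge3 : forall i j, i != j -> (3 <= ord i j)%N;
  vert_hplane : forall i, hplane (vert i);
  vert_side : forall i j, i != j -> ldot (vert i) (side j) = 0;
  vert_in : forall i, ldot (vert i) (side i) < 0 }.

Section Tits.
Variables (R : realType) (T : mirrors R).
Local Notation n_ := (side T).
Implicit Types (k : nat) (i j s t : 'I_3) (w v d : seq 'I_3) (x y : 'cV[R]_3).

Definition refl i : 'M[R]_3 := hrefl (n_ i).
Definition wprod w : 'M[R]_3 := \prod_(i <- w) refl i.
Definition cosine i j : R := cos (pi / (ord T i j)%:R).

Lemma wprod0 : wprod [::] = 1. Proof. exact: big_nil. Qed.
Lemma wprod_cons i w : wprod (i :: w) = refl i * wprod w.
Proof. exact: big_cons. Qed.
Lemma wprod_cat v w : wprod (v ++ w) = wprod v * wprod w.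
Proof. exact: big_cat. Qed.
Lemma wprod1 i : wprod [:: i] = refl i. Proof. exact: big_seq1. Qed.
Lemma wprod_rcons w i : wprod (rcons w i) = wprod w * refl i.
Proof. by rewrite -cats1 wprod_cat wprod1. Qed.

Lemma reflK i : refl i * refl i = 1.
Proof. exact/hrefl_sqr/side_unit. Qed.

Lemma reflE i x : refl i *m x = x - (2 * ldot (n_ i) x) *: n_ i.
Proof. exact/hrefl1E/side_unit. Qed.

Lemma wprod_cons_mul i w x : wprod (i :: w) *m x = refl i *m (wprod w *m x).
Proof. by rewrite wprod_cons mulmxA. Qed.

Lemma wprod_revK w : wprod (rev w) * wprod w = 1.
Proof.
elim: w => [|i w IH]; first by rewrite wprod0 mul1r.
by rewrite rev_cons wprod_rcons wprod_cons -mulrA (mulrA (refl i)) reflK mul1r.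
Qed.

Lemma wprodK_rev w : wprod w * wprod (rev w) = 1.
Proof. by rewrite -{1}(revK w) wprod_revK. Qed.

Lemma wprod_revE w : (wprod w)^-1 = wprod (rev w).
Proof.
have u : wprod w \is a GRing.unit.
  by apply/unitrP; exists (wprod (rev w)); rewrite wprod_revK wprodK_rev.
by apply: (mulrI u); rewrite mulrV // wprodK_rev.
Qed.

Lemma wprod_unit w : wprod w \is a GRing.unit.
Proof. by apply/unitrP; exists (wprod (rev w)); rewrite wprod_revK wprodK_rev. Qed.

Lemma wprod_isom w x y : ldot (wprod w *m x) (wprod w *m y) = ldot x y.
Proof.
elim: w => [|i w IH]; first by rewrite wprod0 !mul1mx.
by rewrite !wprod_cons_mul hrefl_isom ?side_unit.
Qed.

Lemma wprod_adj w x y : ldot (wprod w *m x) y = ldot x (wprod (rev w) *m y).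
Proof.
by rewrite -(wprod_isom (rev w)) mulmxA [_ *m wprod w]wprod_revK mul1mx.
Qed.

Lemma wprod_hplane w x : hplane x -> hplane (wprod w *m x).
Proof.
elim: w => [|i w IH] hx; first by rewrite wprod0 mul1mx.
by rewrite wprod_cons_mul; apply: hrefl_hplane; [exact: side_unit | exact: IH].
Qed.

Lemma wprod_hdist w x y : hdist (wprod w *m x) (wprod w *m y) = hdist x y.
Proof. by rewrite /hdist wprod_isom. Qed.

Lemma det_wprod w : \det (wprod w) = (-1) ^+ size w.
Proof.
elim: w => [|i w IH]; first by rewrite wprod0 det1.
by rewrite wprod_cons det_mulmx IH det_hrefl ?side_unit // exprS.
Qed.

Lemma det_wprod_gt0 w : (0 < \det (wprod w)) = ~~ odd (size w).
Proof. by rewrite det_wprod -signr_odd; case: odd; rewrite ?expr0 ?expr1 ?ltr01 ?ltr0N1. Qed.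

Lemma wprod_parity v w : wprod v = wprod w -> odd (size v) = odd (size w).
Proof. by move=> e; apply/negb_inj; rewrite -!det_wprod_gt0 e. Qed.

Lemma wprod_reflect w n : ldot n n = 1 ->
  wprod w * hrefl n = hrefl (wprod w *m n) * wprod w.
Proof.
move=> nn; apply: mx_ext => x; rewrite -!mulmxA !hrefl1E ?wprod_isom //.
by rewrite mulmxBr -scalemxAr.
Qed.

(** * Dihedral subgroups *)
Fixpoint alt s t k : seq 'I_3 :=
  if k is k'.+1 then (if odd k' then s else t) :: alt s t k' else [::].

Lemma size_alt s t k : size (alt s t k) = k.
Proof. by elim: k => //= k ->. Qed.

Lemma alt_rcons s t k : alt s t k.+1 = rcons (alt t s k) t.
Proof. by elim: k => //= k <-; rewrite /= if_neg. Qed.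

Local Notation u s t := (cheb (pi / (ord T s t)%:R)).

Lemma sin_angle s t : s != t -> 0 < sin (pi / (ord T s t)%:R : R).
Proof. by move=> st; apply: sin_piM_gt0; have := ord_ge3 T st; lia. Qed.

(** The roots of a dihedral group in terms of the simple ones, obtained from the
   three-term recurrence of the Chebyshev polynomials. *)
Lemma alt_root s t k : s != t -> wprod (alt s t k) *m n_ s =
  if odd k then u s t k *: n_ s + u s t k.+1 *: n_ t
  else u s t k.+1 *: n_ s + u s t k *: n_ t.
Proof.
move=> st; have s0 := lt0r_neq0 (sin_angle st).
have ts : t != s by rewrite eq_sym.
elim: k => [|k IH].
  by rewrite wprod0 mul1mx /= cheb0 cheb1 // scale1r scale0r addr0.
rewrite wprod_cons_mul IH chebSS oddS reflE; case: (odd k) => /=.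
  rewrite !ldotS side_unit side_angle //.
  by apply/colP => i; rewrite !mxE; ring.
rewrite !ldotS side_unit side_angle // ordC.
by apply/colP => i; rewrite !mxE; ring.
Qed.

(** The alternating word with one letter less maps a simple root to a simple
   root, since u_(m-1) = 1 and u_m = 0; conjugating a reflection by it is thus
   again a simple reflection. *)
Lemma braid s t : s != t -> wprod (alt s t (ord T s t)) = wprod (alt t s (ord T s t)).
Proof.
move=> st; have s0 := lt0r_neq0 (sin_angle st); have m3 := ord_ge3 T st.
have m2 : (2 <= ord T s t)%N by apply: leq_trans m3.
have [k em] : exists k, ord T s t = k.+1 by case: (ord T s t) m2 => // k; exists k.
rewrite em in s0 m2 *.
rewrite [in RHS]alt_rcons [in LHS]/= wprod_rcons wprod_cons.
rewrite /refl (wprod_reflect _ (side_unit T s)) alt_root // em.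
have um : cheb (pi / k.+1%:R) k.+1 = 0 :> R.
  by rewrite -[X in cheb _ X]subn0 cheb_sym ?cheb0.
have um1 : cheb (pi / k.+1%:R) k = 1 :> R.
  by rewrite -[k in cheb _ k]/(k.+1.-1) -subn1 cheb_sym ?cheb1.
by rewrite um um1 !scale1r !scale0r add0r addr0 /refl; case: odd.
Qed.

End Tits.

(** * Reduced words and the signs of roots *)
Section Reduced.
Variables (R : realType) (T : mirrors R).
Local Notation n_ := (side T).
Local Notation wprod := (wprod T).
Local Notation refl := (refl T).
Implicit Types (k : nat) (i j s t : 'I_3) (w v d : seq 'I_3) (x y : 'cV[R]_3).

Definition reduced w := forall v, wprod v = wprod w -> (size w <= size v)%N.

Lemma reduced_exists w : exists2 v, reduced v & wprod v = wprod w.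
Proof.
elim: {w}(size w) {-2}w (leqnn (size w)) => [|k IH] w wk.
  by exists w => // v _; apply: leq_trans wk _.
have [|/existsNP[v /not_implyP[vw /negP]]] := pselect (reduced w); first by exists w.
rewrite -ltnNge => /leq_trans/(_ wk); rewrite ltnS => /IH[u ru uv].
by exists u => //; rewrite uv.
Qed.

Lemma reduced_catl v w : reduced (v ++ w) -> reduced v.
Proof.
move=> r u uv; have := r (u ++ w); rewrite !wprod_cat uv => /(_ erefl).
by rewrite !size_cat leq_add2r.
Qed.

Lemma reduced_catr v w : reduced (v ++ w) -> reduced w.
Proof.
move=> r u uw; have := r (v ++ u); rewrite !wprod_cat uw => /(_ erefl).
by rewrite !size_cat leq_add2l.
Qed.

Lemma wprod_rev_eq v w : wprod v = wprod w -> wprod (rev v) = wprod (rev w).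
Proof. by rewrite -!wprod_revE => ->. Qed.

Lemma reduced_rev w : reduced w -> reduced (rev w).
Proof.
by move=> r v /wprod_rev_eq; rewrite revK => /r; rewrite !size_rev.
Qed.

Lemma reduced_cancel v i w : ~ reduced (v ++ i :: i :: w).
Proof.
move=> /reduced_catr/(_ w); rewrite !wprod_cons mulrA reflK mul1r => /(_ erefl).
by rewrite /= => h; have := ltn_trans h (ltnSn _); rewrite ltnn.
Qed.

(** Determinants rule out that the length stays the same. *)
Lemma reduced_cut w s : reduced w -> ~ reduced (rcons w s) ->
  exists v, [/\ reduced v, size w = (size v).+1 & wprod v = wprod w * refl s].
Proof.
move=> rw /existsNP[u /not_implyP[uw /negP]]; rewrite -ltnNge size_rcons ltnS => uk.
have [v rv vu] := reduced_exists u.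
have := rv _ (esym vu) => vk.
exists v; have e : wprod v = wprod w * refl s by rewrite vu uw wprod_rcons.
split => //; have := rw (rcons v s).
rewrite wprod_rcons e -mulrA reflK mulr1 size_rcons => /(_ erefl) wk.
have := wprod_parity (esym (etrans e (esym (wprod_rcons T w s)))).
rewrite size_rcons oddS => par.
apply/eqP; rewrite eqn_leq wk ltn_neqAle (leq_trans vk uk) andbT.
by apply/eqP => vw; move: par; rewrite vw; case: odd.
Qed.

(** These are the vectors that are nonpositive on the chamber. *)
Definition posvec x := exists2 b : 'I_3 -> R, forall i, 0 <= b i & x = \sum_i b i *: n_ i.

Lemma posvec_side i : posvec (n_ i).
Proof.
exists (fun j => (j == i)%:R) => [j|]; first exact: ler0n.
rewrite (bigD1 i) //= eqxx scale1r big1 ?addr0 // => j /negPf->.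
by rewrite scale0r.
Qed.

Lemma posvec_lin (a b : R) x y : 0 <= a -> 0 <= b -> posvec x -> posvec y ->
  posvec (a *: x + b *: y).
Proof.
move=> a0 b0 [f f0 ->] [g g0 ->].
exists (fun i => a * f i + b * g i) => [i|]; first by rewrite addr_ge0 // mulr_ge0.
by rewrite !scaler_sumr -big_split /=; apply: eq_bigr => i _; rewrite scalerDl !scalerA.
Qed.

Lemma alt_suffix s t v d : s != t -> all [in [:: s; t]] d -> reduced (v ++ rcons d s) ->
  d = alt s t (size d).
Proof.
move=> st; elim: d v => [//|x d IH] v /= /andP[xst dst] r.
have ed := IH (rcons v x) dst; rewrite cat_rcons in ed; move/(_ r): ed => ed.
rewrite {1}ed; congr (_ :: _); move: xst; rewrite !inE.
case: d {IH dst} ed r => [|y d] /= ed r.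
  by case/orP=> /eqP // ex; case: (@reduced_cancel v s [::]); move: r; rewrite ex.
case: ed => ey _; rewrite ey in r; move: r; case: (odd (size d)) => /= r.
  by case/orP=> /eqP // ex; case: (@reduced_cancel v s (rcons d s)); move: r; rewrite ex.
by case/orP=> /eqP // ex; case: (@reduced_cancel v t (rcons d s)); move: r; rewrite ex.
Qed.

Lemma alt_short s t v k : s != t -> reduced (v ++ rcons (alt s t k) s) -> (k < ord T s t)%N.
Proof.
move=> st r; rewrite ltnNge; apply/negP => km.
have [w ew] : exists w, alt s t k = w ++ alt s t (ord T s t).
  rewrite -(subnK km) addnC; elim: (k - _)%N => [|e [w ew]].
    by exists [::]; rewrite addn0.
  by rewrite addnS /= ew; eexists (_ :: w).
have m3 := ord_ge3 T st; move: r; rewrite ew.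
case em : (ord T s t) => [|m]; first by rewrite em in m3.
rewrite rcons_cat -em => /reduced_catr/reduced_catr.
move=> /(_ (alt s t m)).
rewrite wprod_rcons (braid T st) em alt_rcons wprod_rcons -mulrA reflK mulr1.
by move=> /(_ erefl); rewrite size_rcons !size_alt => h; have := ltn_trans h (ltnSn _); rewrite ltnn.
Qed.

(** Split w as v d with d the longest possible word in s and the last letter t
   of w.  By maximality both v s and v t are longer than v, so that v n_s and
   v n_t are positive by induction; and d is an alternating word shorter than
   m_st, so that d n_s is a nonnegative combination of n_s and n_t. *)
Lemma tits w s : reduced (rcons w s) -> posvec (wprod w *m n_ s).
Proof.
elim: {w}(size w) {-2}w (leqnn (size w)) s => [|k IH] w wk s r.
  by move: wk; case: w r => // _ _; rewrite wprod0 mul1mx; apply: posvec_side.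
have rw : reduced w by move: r; rewrite -cats1 => /reduced_catl.
case/lastP: w => [|w t] in wk r rw *.
  by rewrite wprod0 mul1mx; apply: posvec_side.
have st : s != t.
  by apply/eqP => est; case: (@reduced_cancel w s [::]); move: r; rewrite est -!cats1 -catA.
set N := size (rcons w t) in wk *.
pose P (d0 : nat) := `[< exists v d, [/\ size d = d0, (size v + d0)%N = N,
   wprod (v ++ d) = wprod (rcons w t) & all [in [:: s; t]] d] >].
have P1 : P 1%N.
  apply/asboolP; exists w, [:: t]; rewrite cats1 /N size_rcons addn1 /= !inE eqxx orbT.
  by split.
have Pub (d0 : nat) : P d0 -> (d0 <= N)%N by move=> /asboolP[v [d [_ <- _ _]]]; rewrite leq_addl.
have [d0 /asboolP[v [d [sd sv e dst]]] dmax] := ex_maxnP (ex_intro (fun k => P k) 1%N P1) Pub.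
have d0gt : (0 < d0)%N by apply: dmax P1.
have rvd : reduced (v ++ d).
  by move=> u; rewrite e => /rw; rewrite size_cat sd sv.
have cut i : i \in [:: s; t] -> reduced (rcons v i).
  move=> ist; apply: contrapT => /(reduced_cut (reduced_catl rvd))[u [ru su eu]].
  have : P d0.+1.
    apply/asboolP; exists u, (i :: d); split=> //=; first by rewrite sd.
    - by rewrite -sv su addnS.
    - by rewrite -e !wprod_cat wprod_cons eu mulrA -(mulrA (wprod v)) reflK mulr1.
    - by rewrite ist.
  by move=> /dmax; rewrite ltnn.
have vk : (size v <= k)%N by move: wk; rewrite -sv; lia.
have pv i : i \in [:: s; t] -> posvec (wprod v *m n_ i) by move=> /cut; apply: IH.
have rvds : reduced (v ++ rcons d s).
  move=> u; rewrite -rcons_cat wprod_rcons e -wprod_rcons => /r.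
  by rewrite !size_rcons size_cat sd sv /N size_rcons.
have ed := alt_suffix st dst rvds; rewrite ed in rvds.
have dm := alt_short st rvds.
rewrite -e wprod_cat -mulmxA ed alt_root //.
have m2 : (2 <= ord T s t)%N by apply: leq_trans (ord_ge3 T st).
have u1 := @cheb_ge0 R _ _ m2 dm; have u0 := @cheb_ge0 R _ _ m2 (ltnW dm).
have ps := pv s (mem_head _ _).
have pt : posvec (wprod v *m n_ t) by apply: pv; rewrite !inE eqxx orbT.
by case: odd; rewrite mulmxDr -!scalemxAr; apply: posvec_lin; auto.
Qed.

Lemma ldot_sum x (b : 'I_3 -> R) :
  ldot x (\sum_i b i *: n_ i) = \sum_i b i * ldot x (n_ i).
Proof. by rewrite !sum3 !ldotS. Qed.

(** The cone over the triangle; the normals point outwards. *)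
Definition chamber x := forall i, ldot x (n_ i) <= 0.

Lemma chamber_posvec x y : chamber x -> posvec y -> ldot x y <= 0.
Proof.
move=> cx [b b0 ->]; rewrite ldot_sum; apply: sumr_le0 => i _.
by rewrite mulr_ge0_le0.
Qed.

Lemma chamber_cons w s x : reduced (s :: w) -> chamber x ->
  ldot (wprod w *m x) (n_ s) <= 0.
Proof.
move=> /reduced_rev; rewrite rev_cons => /tits p cx.
by rewrite wprod_adj; apply: chamber_posvec.
Qed.

Lemma ldot_refl_side s x : ldot (refl s *m x) (n_ s) = - ldot x (n_ s).
Proof. by rewrite reflE !ldotS side_unit (ldotC _ x); ring. Qed.

(** If the image of the chamber meets the far side of the line s, then this
   line separates the chamber from its image. *)
Lemma descent w s x : reduced w -> chamber x -> 0 < ldot (wprod w *m x) (n_ s) ->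
  exists v, [/\ reduced v, size w = (size v).+1 & wprod v = refl s * wprod w].
Proof.
move=> rw cx h.
have : ~ reduced (rcons (rev w) s).
  rewrite -rev_cons => /reduced_rev; rewrite revK => r.
  by have := chamber_cons r cx; rewrite leNgt h.
move=> /(reduced_cut (reduced_rev rw))[v [rv sv ev]].
exists (rev v); rewrite size_rev -sv size_rev; split=> //; first exact: reduced_rev.
by rewrite -wprod_cons -[s :: w]revK; apply: wprod_rev_eq; rewrite rev_cons wprod_rcons.
Qed.

(** Otherwise a line s separates the chamber from its image under w, and an
   interior point of the image is strictly beyond that line. *)
Lemma chamber_interior w x : (forall i, ldot x (n_ i) < 0) -> chamber (wprod w *m x) ->
  wprod w = 1.
Proof.
move=> ix; have [v rv <-] := reduced_exists w.
case: v rv => [|s v] rv cx; first exact: wprod0.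
have /reduced_rev := rv; rewrite rev_cons => /tits [b b0 eb].
have := cx s; rewrite wprod_cons_mul ldot_refl_side wprod_adj eb oppr_le0 => h.
have b0' i : b i = 0.
  apply/eqP; rewrite eq_le b0 andbT leNgt; apply/negP => bi.
  move: h; rewrite leNgt => /negP; apply.
  rewrite ldot_sum (bigD1 i) //= ltr_nwDl ?nmulr_llt0 //.
  by apply: sumr_le0 => j _; rewrite mulr_ge0_le0 // ltW.
have : ldot (wprod (rev v) *m n_ s) (wprod (rev v) *m n_ s) = 1.
  by rewrite wprod_isom side_unit.
rewrite eb big1 => [|i _]; last by rewrite b0' scale0r.
by rewrite ldotE !mxE !mul0r oppr0 !addr0 => /esym/eqP; rewrite oner_eq0.
Qed.

End Reduced.

(** * The translates of the triangle cover the plane *)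
Section Covering.
Variables (R : realType) (T : mirrors R).
Local Notation n_ := (side T).
Local Notation wprod := (wprod T).
Local Notation refl := (refl T).
Local Notation reduced := (reduced T).
Local Notation chamber := (chamber T).
Implicit Types (k : nat) (i j s t : 'I_3) (w v d : seq 'I_3) (x y z : 'cV[R]_3).

Lemma interior_point : exists2 z, hplane z & forall i, ldot z (n_ i) < 0.
Proof.
have h := vert_hplane T.
have [k k0 hy] : exists2 k : R, 0 < k & hplane ((k * 1) *: vert T 0 + (k * 1) *: vert T 1).
  by apply: hplane_normalize.
set y := _ + _ in hy.
have [l l0 hz] : exists2 l : R, 0 < l & hplane ((l * 1) *: y + (l * 1) *: vert T 2%R).
  by apply: hplane_normalize.
exists ((l * 1) *: y + (l * 1) *: vert T 2%R) => //.
have := vert_in T; have v := vert_side T => neg.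
have lk : 0 < l * k by rewrite mulr_gt0.
apply: all3; rewrite /y !ldotS !mulr1 ?(v 1 0) ?(v 2%R 0) ?(v 0 1) ?(v 2%R 1) ?(v 0 2%R) ?(v 1 2%R) //.
- by rewrite !mulr0 !addr0 mulrA pmulr_rlt0.
- by rewrite !mulr0 add0r addr0 mulrA pmulr_rlt0.
- by rewrite !(mulr0, add0r) pmulr_rlt0.
Qed.

(** A nonnegative combination of the normals of norm 1 has coefficients of sum
   at least 1, since all inner products of the normals are at most 1. *)
Lemma posroot_le w s x (e : R) : reduced (rcons w s) -> 0 <= e ->
  (forall i, ldot x (n_ i) <= - e) -> ldot x (wprod w *m n_ s) <= - e.
Proof.
move=> /tits[b b0 eb] e0 xe; rewrite eb ldot_sum.
have b1 : 1 <= \sum_i b i.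
  have : ldot (wprod w *m n_ s) (wprod w *m n_ s) = 1 by rewrite wprod_isom side_unit.
  have le1 i j : ldot (n_ i) (n_ j) <= 1.
    have [<-|ij] := eqVneq i j; first by rewrite side_unit.
    by rewrite side_angle // lerNl cos_geN1.
  have : ldot (\sum_i b i *: n_ i) (\sum_i b i *: n_ i) <= (\sum_i b i) ^+ 2.
    rewrite ldot_sum expr2 mulr_suml; apply: ler_sum => i _; apply: ler_wpM2l => //.
    by rewrite ldotC ldot_sum; apply: ler_sum => j _; apply: ler_piMr.
  rewrite eb => h1 h2; rewrite h2 in h1.
  have s0 : 0 <= \sum_i b i by apply: sumr_ge0.
  by rewrite -(@expr_ge1 _ 2).
apply: (@le_trans _ _ (\sum_i b i * - e)).
  by apply: ler_sum => i _; apply: ler_wpM2l.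
by rewrite -mulr_suml mulrN lerN2 ler_peMl.
Qed.

(** Every letter of a reduced word adds at least 2 e^2. *)
Lemma growth w z (e : R) : reduced w -> hplane z -> 0 <= e ->
  (forall i, ldot z (n_ i) <= - e) -> 2 * e ^+ 2 * (size w)%:R <= - ldot z (wprod w *m z).
Proof.
move=> rw hz e0 ze; elim: w rw => [|s w IH] rw.
  by rewrite wprod0 mul1mx mulr0 (proj1 hz) opprK.
have {}IH := IH (@reduced_catr _ _ [:: s] _ rw).
have h1 : ldot z (wprod (rev w) *m n_ s) <= - e.
  by apply: posroot_le => //; rewrite -rev_cons; apply: reduced_rev.
rewrite -wprod_adj ldotC in h1.
rewrite wprod_cons_mul reflE !ldotS (ldotC (n_ s)) (ldotC (wprod w *m z) (n_ s)) /= -natr1.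
have h2 : ldot z (n_ s) <= - e by apply: ze.
have : e ^+ 2 <= ldot (n_ s) (wprod w *m z) * ldot z (n_ s).
  rewrite -[X in _ <= X]mulrNN expr2; apply: ler_pM => //; rewrite lerNr //.
by rewrite (ldotC z (n_ s)) (ldotC (n_ s) z); lra.
Qed.

(** A form of cosh (s + t) <= 2 cosh s cosh t. *)
Lemma ldot_triangle x y z : hplane x -> hplane y -> hplane z ->
  - ldot x z <= 2 * (ldot x y * ldot y z).
Proof.
move=> hx hy hz.
have := hplane_ldot hx hy; have := hplane_ldot hy hz; have := hplane_ldot hx hz.
have := gram3_le0 x y z; rewrite (proj1 hx) (proj1 hy) (proj1 hz).
move: (ldot x y) (ldot y z) (ldot x z) => a b c G c1 b1 a1.
have ab : 0 <= a * b by rewrite mulr_le0 //; lra.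
have h : (- c - a * b) ^+ 2 <= (a * b) ^+ 2.
  have : 1 <= a ^+ 2 by rewrite -sqrrN exprn_ege1 //; lra.
  have : 1 <= b ^+ 2 by rewrite -sqrrN exprn_ege1 //; lra.
  move=> h1 h2; have -> : (a * b) ^+ 2 = a ^+ 2 * b ^+ 2 by ring.
  lra.
have := ler_norm (- c - a * b); have : `| - c - a * b | <= a * b; last lra.
by rewrite -sqrtr_sqr -[X in _ <= X]ger0_norm // -[X in _ <= X]sqrtr_sqr ler_wsqrtr.
Qed.

(** Among the translates of an interior point z, one is closest to x, because
   only finitely many words keep z within a given distance.  The bisector of
   z and its mirror image in a side is that side, so that x lies in the
   corresponding translate of the chamber. *)
Lemma covering x : hplane x -> exists w, chamber (wprod w *m x).
Proof.
move=> hx; have [z hz zn] := interior_point.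
have [e e0 ze] : exists2 e : R, 0 < e & forall i, ldot z (n_ i) <= - e.
  exists (Num.min (- ldot z (n_ 0)) (Num.min (- ldot z (n_ 1)) (- ldot z (n_ 2%R)))).
    by rewrite !lt_min !oppr_gt0 !zn.
  by apply: all3; rewrite lerNr !ge_min lexx ?orbT.
pose B := - ldot x z.
have B1 : 1 <= B by have := hplane_ldot hx hz; rewrite /B; lra.
pose f w := - ldot x (wprod w *m z).
pose N := Num.bound (B ^+ 2 / e ^+ 2).
have far w : reduced w -> (N < size w)%N -> B <= f w.
  move=> rw Nw; have g := growth rw hz (ltW e0) ze.
  have := ldot_triangle hz hx (wprod_hplane T w hz).
  rewrite (ldotC z x) -[ldot x z]opprK -/B -[ldot x (_ *m _)]opprK -/(f w) mulrNN => h.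
  have B2 : B ^+ 2 < e ^+ 2 * (size w)%:R.
    rewrite mulrC -ltr_pdivrMr ?exprn_gt0 //.
    apply: (lt_le_trans (archi_boundP _)); first by rewrite divr_ge0 // sqr_ge0.
    by rewrite ler_nat ltnW.
  have : B * B <= B * f w by rewrite -expr2; lra.
  by rewrite ler_pM2l //; lra.
pose ev (t : N.-tuple (option 'I_3)) := pmap id t.
have evP w : (size w <= N)%N -> exists t : N.-tuple _, ev t = w.
  move=> wN; have sz : size (map Some w ++ nseq (N - size w) None) == N.
    by rewrite size_cat size_map size_nseq subnKC.
  exists (Tuple sz); rewrite /ev /= pmap_cat map_pK // (_ : pmap id _ = [::]) ?cats0 //.
  by elim: (_ - _)%N.
have [t0 _] := evP [::] (leq0n _).
have [t _ tmin] := @arg_minP _ _ _ t0 predT (fun t : N.-tuple _ => f (ev t)) isT.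
set w := ev t in tmin.
have min0 v : f w <= f v.
  have [v' rv vv] : exists2 v', reduced v' & f v' = f v.
    by have [v' rv e'] := reduced_exists T v; exists v'; rewrite /f ?e'.
  rewrite -vv; have [Nv|vN] := ltnP N (size v'); last first.
    by by have [t' <-] := evP _ vN; apply: tmin.
  apply: le_trans (far _ rv Nv).
  have [t' et] := evP [::] (leq0n _); have := tmin t' isT.
  by rewrite et /f wprod0 mul1mx.
exists (rev w) => i; rewrite leNgt; apply/negP => h.
have := min0 (rcons w i); rewrite /f wprod_rcons -mulmxA !(ldotC x) !wprod_adj reflE !ldotS.
have := zn i; rewrite (ldotC (n_ i) z) (ldotC (n_ i)) => zi.
have : ldot z (n_ i) * ldot (wprod (rev w) *m x) (n_ i) < 0 by rewrite nmulr_rlt0.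
lra.
Qed.

End Covering.

(** * Billiard words *)
Section Words.
Implicit Types (w v b : seq 'I_3).

(** Some cyclic rotation of 0 1 0 2 is a subsequence of w: in the cyclic word w,
   two occurrences of 0 separate some 1 from some 2. *)
Definition splits w := [|| subseq [:: 0; 1; 0; 2%R] w, subseq [:: 0; 2%R; 0; 1] w,
   subseq [:: 1; 0; 2%R; 0] w | subseq [:: 2%R; 0; 1; 0] w].

Lemma last_split (x : 'I_3) w : x \in w -> exists w1 w2, w = w1 ++ x :: w2 /\ x \notin w2.
Proof.
elim: w => // y w IH; rewrite inE => xw.
have [/IH[w1 [w2 [-> h]]]|nxw] := boolP (x \in w); first by exists (y :: w1), w2.
by move: xw; rewrite (negPf nxw) orbF => /eqP <-; exists [::], w.
Qed.

Lemma first_split (x : 'I_3) w : x \in w -> exists w1 w2, w = w1 ++ x :: w2 /\ x \notin w1.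
Proof.
rewrite -mem_rev => /last_split[w1 [w2 [e h]]].
exists (rev w2), (rev w1); split; last by rewrite mem_rev.
by rewrite -[w]revK e rev_cat rev_cons cat_rcons.
Qed.

Lemma splits_outer (s t : 'I_3) b0 w bk : (s, t) \in [:: (1, 2%R); (2%R, 1)] ->
  ~~ splits (b0 ++ 0 :: w ++ 0 :: bk) -> s \in b0 ++ bk -> t \notin w.
Proof.
move=> st nsp sb; apply: contra nsp => tw.
move: sb; rewrite mem_cat => /orP[sb|sb].
  have : subseq ([:: s] ++ [:: 0] ++ [:: t] ++ [:: 0]) (b0 ++ [:: 0] ++ w ++ [:: 0] ++ bk).
    apply: cat_subseq; first by rewrite sub1seq.
    apply: cat_subseq => //; apply: cat_subseq; first by rewrite sub1seq.
    exact: prefix_subseq.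
  by move: st; rewrite /splits !inE => /orP[] /eqP[-> ->] /= ->; rewrite ?orbT.
have : subseq ([::] ++ [:: 0] ++ [:: t] ++ [:: 0] ++ [:: s]) (b0 ++ [:: 0] ++ w ++ [:: 0] ++ bk).
  apply: cat_subseq; first exact: sub0seq.
  apply: cat_subseq => //; apply: cat_subseq; first by rewrite sub1seq.
  by apply: cat_subseq => //; rewrite sub1seq.
by move: st; rewrite /splits !inE => /orP[] /eqP[-> ->] /= ->; rewrite ?orbT.
Qed.

Lemma splits_sub v w : subseq v w -> ~~ splits w -> ~~ splits v.
Proof.
move=> vw; apply: contra; rewrite /splits.
by case/or4P => h; rewrite (subseq_trans h vw) ?orbT.
Qed.

Lemma letter_cases (i : 'I_3) : [\/ i = 0, i = 1 | i = 2%R].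
Proof. by move: i; apply: all3; [apply: Or31 | apply: Or32 | apply: Or33]. Qed.

End Words.

Section Gallery.
Variables (R : realType) (T : mirrors R).
Local Notation n_ := (side T).
Local Notation wprod := (wprod T).
Local Notation refl := (refl T).
Local Notation reduced := (reduced T).
Local Notation chamber := (chamber T).
Implicit Types (k : nat) (i j s t : 'I_3) (w v d : seq 'I_3) (x y z : 'cV[R]_3).
Implicit Types (ps : seq ('I_3 * 'cV[R]_3)).

Fixpoint path_len x ps y : R :=
  if ps is (_, p) :: ps' then hdist x p + path_len p ps' y else hdist x y.

Fixpoint on_sides ps : Prop :=
  if ps is (i, p) :: ps' then [/\ hplane p, ldot p (n_ i) = 0 & on_sides ps'] else True.

Lemma path_len_ge x ps y : hplane x -> hplane y -> on_sides ps ->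
  hdist x y <= path_len x ps y.
Proof.
move=> + hy; elim: ps x => [|[i p] ps IH] x hx //= [hp _ ops].
by apply: (le_trans (hdist_triangle hx hp hy)); rewrite lerD2l IH.
Qed.

Lemma on_sides_mask m ps : on_sides ps -> on_sides (mask m ps).
Proof.
elim: ps m => [|[i p] ps IH] [|[] m] //= [hp pi ops]; last exact: IH.
by split=> //; apply: IH.
Qed.

Lemma path_len_mask m x ps y : hplane x -> hplane y -> on_sides ps ->
  path_len x (mask m ps) y <= path_len x ps y.
Proof.
move=> + hy; elim: ps m x => [|[i p] ps IH] m x hx; first by case: m => [|[] m].
case: m => [|[] m] ops; first exact: (path_len_ge hx hy ops).
  by case: ops => [hp _ ops] /=; rewrite lerD2l IH.
rewrite [mask _ _]/=; apply: le_trans (IH m x hx _) _; first by case: ops.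
case: ops => [hp _ ops] /=.
case: ps {IH} ops => [|[j q] ps] /= ops; first exact: hdist_triangle.
by case: ops => hq _ _; rewrite addrA lerD2r hdist_triangle.
Qed.

(** Induction on the length of w.  The segment from x to the image of y leaves
   the chamber through a side line j, which shortens w by descent; the exit
   point is the next bounce, and reflecting the rest of the segment in j
   leaves a shorter word.  When the image of y is still in the chamber although
   w is not trivial, it lies on the line of the first letter of w, and then it
   serves as a bounce itself. *)
Lemma gallery w x y : hplane x -> chamber x -> hplane y -> chamber y ->
  exists ps, [/\ on_sides ps, wprod (map fst ps) = wprod w &
    path_len x ps y <= hdist x (wprod w *m y)].
Proof.
move=> + + hy cy; have [v rv <-] := reduced_exists T w.
elim: {v}(size v) {-2}v (erefl (size v)) rv x => [|k IH] v sv rv x hx cx.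
  by case: v sv {rv} => // _; exists [::]; rewrite wprod0 mul1mx.
set z := wprod v *m y; have hz : hplane z by apply: wprod_hplane.
have step s v' q : reduced v' -> size v' = k -> wprod v' = refl s * wprod v ->
    hplane q -> chamber q -> ldot q (n_ s) = 0 -> hdist x z = hdist x q + hdist q z ->
  exists ps, [/\ on_sides ps, wprod (map fst ps) = wprod v & path_len x ps y <= hdist x z].
  move=> rv' sv' ev' hq cq qs e.
  have [ps [ops eps lps]] := IH _ sv' rv' q hq cq.
  exists ((s, q) :: ps); split=> //=.
    by rewrite wprod_cons eps ev' mulrA reflK mul1r.
  rewrite e lerD2l; apply: le_trans lps _.
  have sq : ldot (n_ s) q = 0 by rewrite ldotC.
  by rewrite ev' -mulmxA -/z -{1}(hrefl_fix (side_unit T s) sq) hdist_hrefl ?side_unit.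
have [out|inz] := pselect (exists j, 0 < ldot z (n_ j)); last first.
  have cz : chamber z by move=> j; rewrite leNgt; apply/negP => h; apply: inz; exists j.
  case: v sv rv @z hz step inz cz => // s v [sv] rv z hz step _ cz.
  apply: (step s v z) => //; first exact: (@reduced_catr _ _ [:: s]).
  - by rewrite wprod_cons mulrA reflK mul1r.
  - apply/eqP; rewrite eq_le cz /=; have := chamber_cons rv cy.
    rewrite -[wprod v]mul1r -(reflK T s) -mulrA -wprod_cons -mulmxA.
    by rewrite ldot_refl_side oppr_le0.
  - by rewrite hdist_refl // addr0.
have [j0 zj0] := out.
pose t i : R := - ldot x (n_ i) / (ldot z (n_ i) - ldot x (n_ i)).
have den i : 0 < ldot z (n_ i) -> 0 < ldot z (n_ i) - ldot x (n_ i).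
  by move=> h; have := cx i; lra.
have [j zj tmin] := @arg_minP _ _ _ j0 (fun i => 0 < ldot z (n_ i)) t zj0.
have dj := den _ zj.
have t0 : 0 <= t j by rewrite divr_ge0 ?(ltW dj) // oppr_ge0.
have t1 : t j <= 1 by rewrite ler_pdivrMr // mul1r; lra.
have tj : t j * (ldot z (n_ j) - ldot x (n_ j)) = - ldot x (n_ j).
  by rewrite mulfVK // gt_eqF.
have {}tmin i : 0 < ldot z (n_ i) -> t j * (ldot z (n_ i) - ldot x (n_ i)) <= - ldot x (n_ i).
  by move=> zi; have := tmin _ zi; rewrite {2}/t ler_pdivlMr ?den.
move: (t j) t0 t1 tj tmin => {t} a a0 a1 aj amin.
have [c c0 hq] : exists2 c : R, 0 < c & hplane ((c * (1 - a)) *: x + (c * a) *: z).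
  by apply: hplane_normalize => //; lra.
have [v' [rv' sv' ev']] := descent rv cy zj.
apply: (step j v' _ rv' _ ev' hq).
- by move: sv'; rewrite sv => -[].
- move=> i; rewrite !ldotS -!mulrA -mulrDr pmulr_rle0 //.
  have xi := cx i; have [zi|zi] := ltP 0 (ldot z (n_ i)).
    by have := amin _ zi; lra.
  have : 0 <= (1 - a) * - ldot x (n_ i) by apply: mulr_ge0; lra.
  have : 0 <= a * - ldot z (n_ i) by apply: mulr_ge0; lra.
  by lra.
- rewrite !ldotS -!mulrA -mulrDr; apply/eqP; rewrite mulf_eq0 gt_eqF //=; apply/eqP.
  by lra.
- by apply: hdist_segment => //; apply: mulr_ge0; lra.
Qed.

End Gallery.

(** * Closed polygons and dihedral words *)
Section Cases.
Variables (R : realType) (T : mirrors R).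
Local Notation n_ := (side T).
Local Notation wprod := (wprod T).
Local Notation refl := (refl T).
Local Notation c_ := (cosine T).
Implicit Types (k : nat) (i j s t : 'I_3) (w v b d : seq 'I_3) (x y z n : 'cV[R]_3).

Lemma wprod_zeros w : all (pred1 0) w ->
  wprod w = if odd (size w) then refl 0 else 1.
Proof.
elim: w => [_|i w IH] /=; first exact: wprod0.
by case/andP=> /eqP-> /IH; rewrite wprod_cons => ->; case: odd; rewrite ?mulr1 ?reflK.
Qed.

(** Let b0 and bk be the parts of w outside its first and its last letter 0,
   and w' the part inside.  Since nothing splits, a letter 1 outside excludes
   a letter 2 inside, and vice versa.  If both occur outside, then w' consists
   of letters 0; if one occurs, then w misses the other; if none does, then w
   is w' conjugated by the reflection in side 0. *)
Lemma word_cases w : ~~ splits w -> exists v b,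
  wprod w = wprod (v ++ b ++ rev v) /\
  ((exists i, i \notin b) \/ (exists2 b', b = 0 :: b' & 0 \notin b')).
Proof.
elim: {w}(size w) {-2}w (leqnn (size w)) => [|k IH] w wk nsp.
  by move: wk; case: w {nsp} => // _; exists [::], [::]; split=> //; left; exists 0.
have [w0|w0] := boolP (0 \in w); last first.
  by exists [::], w; rewrite cats0; split=> //; left; exists 0.
have [b0 [w1 [ew nb0]]] := first_split w0.
have [w10|w10] := boolP (0 \in w1); last first.
  exists b0, (0 :: w1 ++ b0); split; last first.
    by right; exists (w1 ++ b0) => //; rewrite mem_cat negb_or w10.
  by rewrite ew /= -catA !wprod_cat !wprod_cons !wprod_cat wprodK_rev mulr1.
have [w' [bk [ew1 nbk]]] := last_split w10.
rewrite {}ew1 in ew => {w1 w10}; rewrite {}ew in nsp wk * => {w w0}.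
set w := b0 ++ _ in nsp wk *.
have out1 : 1 \in b0 ++ bk -> 2%R \notin w' by apply: splits_outer nsp.
have out2 : 2%R \in b0 ++ bk -> 1 \notin w' by apply: splits_outer nsp.
have nout : 0 \notin b0 ++ bk by rewrite mem_cat negb_or nb0.
have memw i : i != 0 -> (i \in w) = (i \in b0 ++ bk) || (i \in w').
  move=> i0; rewrite /w !mem_cat !inE mem_cat inE (negPf i0) /= orbA.
  by rewrite -!orbA; case: (_ \in b0) => //=; rewrite orbC.
have [h1|h1] := boolP (1 \in b0 ++ bk); have [h2|h2] := boolP (2%R \in b0 ++ bk).
- have z : all (pred1 0) (0 :: rcons w' 0).
    rewrite /= all_rcons /=; apply/allP => i iw; apply/eqP.
    by case: (letter_cases i) iw => // ->; rewrite ?(negPf (out1 h1)) ?(negPf (out2 h2)).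
  have ew : wprod w = wprod b0 * (wprod (0 :: rcons w' 0) * wprod (bk ++ b0)) * wprod (rev b0).
    rewrite /w !(wprod_cat, wprod_cons, wprod_rcons) !mulrA.
    by rewrite -(mulrA _ (wprod b0) (wprod (rev b0))) wprodK_rev mulr1.
  move: ew; rewrite (wprod_zeros z).
  case: ifP => _ ew.
    exists b0, (0 :: bk ++ b0); split; last first.
      by right; exists (bk ++ b0) => //; move: nout; rewrite !mem_cat orbC.
    by rewrite ew !wprod_cat wprod_cons wprod_cat !mulrA.
  exists b0, (bk ++ b0); split; last by left; exists 0; move: nout; rewrite !mem_cat orbC.
  by rewrite ew mul1r !wprod_cat !mulrA.
- exists [::], w; rewrite cats0; split=> //; left; exists 2%R.
  by rewrite memw // negb_or h2 out1.
- exists [::], w; rewrite cats0; split=> //; left; exists 1.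
  by rewrite memw // negb_or h1 out2.
have eout : b0 ++ bk = [::].
  case: (b0 ++ bk) h1 h2 nout => // i l; rewrite !inE !negb_or.
  by case: (letter_cases i) => ->; rewrite eqxx.
have [eb0 ebk] : b0 = [::] /\ bk = [::] by case: b0 bk eout {h1 h2 nout memw out1 out2 w nsp wk nb0 nbk} => [|//] [].
have sub : subseq w' w.
  by rewrite /w eb0 ebk /=; apply: subseq_trans (subseq_cons _ _); apply: prefix_subseq.
have [||v [b [e gb]]] := IH w'; last 1 first.
- exists (0 :: v), b; split=> //.
  rewrite /w eb0 ebk /= wprod_cons wprod_cat e rev_cons -cats1.
  by rewrite -(wprod_cat T (v ++ _)) -wprod_cons -!catA.
- move: wk; rewrite /w eb0 ebk /= size_cat /=; lia.
- exact: splits_sub sub nsp.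
Qed.

(** Letters are put in front one by one; they cancel or lengthen the alternating
   word, and a word of maximal length is first turned over by the braid
   relation. *)
Lemma dihedral_word s t d : s != t -> all [in [:: s; t]] d ->
  exists a e k, [/\ (a, e) \in [:: (s, t); (t, s)], (k <= ord T s t)%N &
    wprod d = wprod (alt a e k)].
Proof.
move=> st; elim: d => [_|i d IH /= /andP[ist /IH[a [e [k [xy km ed]]]]]].
  by exists s, t, 0%N; rewrite inE eqxx.
have yx : (e, a) \in [:: (s, t); (t, s)].
  by move: xy; rewrite !inE => /orP[] /eqP[-> ->]; rewrite eqxx ?orbT.
have iae : i \in [:: a; e].
  by move: xy ist; rewrite !inE => /orP[] /eqP[-> ->] //; rewrite orbC.
rewrite wprod_cons ed; case: k km ed => [|k] km ed.
  have m1 : (0 < ord T s t)%N by have := ord_ge3 T st; lia.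
  move: iae; rewrite !inE => /orP[] /eqP->; last by exists a, e, 1%N; rewrite wprod_cons.
  by exists e, a, 1%N; rewrite wprod_cons.
have [ei|ni] := eqVneq i (if odd k then a else e).
  exists a, e, k; split=> //; first exact: ltnW.
  by rewrite ei /= wprod_cons mulrA reflK mul1r.
have ei : i = (if odd k then e else a).
  by move: iae ni; rewrite !inE; case: odd => /orP[] /eqP->; rewrite ?eqxx.
have [kM|Mk] := ltnP k.+1 (ord T s t).
  by exists a, e, k.+2; split=> //; rewrite ei [in RHS]/= if_neg [in RHS]wprod_cons.
have kord : k.+1 = ord T a e.
  have -> : ord T a e = ord T s t.
    by move: xy; rewrite !inE => /orP[] /eqP[-> ->] //; rewrite ordC.
  by apply/eqP; rewrite eqn_leq km.
exists e, a, k; split=> //; first exact: ltnW.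
have ae : a != e by move: xy; rewrite !inE => /orP[] /eqP[-> ->] //; rewrite eq_sym.
by rewrite kord (braid T ae) -kord ei /= wprod_cons mulrA reflK mul1r.
Qed.

Lemma dihedral_root_unit s t (j : nat) (u := cheb (pi / (ord T s t)%:R)) : s != t ->
  ldot (u j.+1 *: n_ t + u j *: n_ s) (u j.+1 *: n_ t + u j *: n_ s) = 1.
Proof.
move=> st; have s0 := lt0r_neq0 (sin_angle T st).
have ts : t != s by rewrite eq_sym.
rewrite !ldotS !side_unit (side_angle T st) (side_angle T ts) (ordC T t s).
have := cos2Dsin2 (pi / (ord T s t)%:R : R).
have ej : j.+1%:R * (pi / (ord T s t)%:R) = j%:R * (pi / (ord T s t)%:R) + pi / (ord T s t)%:R :> R.
  by rewrite -natr1; ring.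
rewrite /u /cheb ej sinD.
have := cos2Dsin2 (j%:R * (pi / (ord T s t)%:R) : R).
move: (cos (j%:R * _)) (sin (j%:R * _)) (cos (pi / _)) (sin (pi / _)) s0 => a b c d d0 ab cd.
transitivity (((b * c + a * d) ^+ 2 + b ^+ 2 - 2 * c * (b * c + a * d) * b) / d ^+ 2).
  by field.
have -> : (b * c + a * d) ^+ 2 + b ^+ 2 - 2 * c * (b * c + a * d) * b = d ^+ 2.
  transitivity (b ^+ 2 * (1 - c ^+ 2) + a ^+ 2 * d ^+ 2); first by ring.
  by rewrite -cd; transitivity (d ^+ 2 * (a ^+ 2 + b ^+ 2)); [ring | rewrite ab mulr1].
by rewrite divff // expf_neq0.
Qed.

(** An alternating word of odd length is a palindrome, hence the reflection in
   the image of the simple root of its middle letter. *)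
Lemma alt_reflection s t (j : nat) : s != t -> wprod (alt s t j.*2.+1) =
  hrefl (cheb (pi / (ord T s t)%:R) j.+1 *: n_ t + cheb (pi / (ord T s t)%:R) j *: n_ s).
Proof.
elim: j s t => [|j IH] s t st; have s0 := lt0r_neq0 (sin_angle T st).
  by rewrite wprod1 cheb0 cheb1 // scale1r scale0r addr0.
have ts : t != s by rewrite eq_sym.
rewrite doubleS alt_rcons wprod_rcons.
have -> : alt t s j.*2.+2 = t :: alt t s j.*2.+1 by rewrite /= odd_double.
rewrite wprod_cons IH // (ordC T t s) -(wprod1 T t) -mulrA.
set z := _ + _.
have zz : ldot z z = 1 by rewrite /z -(ordC T t s) dihedral_root_unit.
rewrite mulrA (wprod_reflect _ _ zz) -mulrA wprod1 reflK mulr1; congr hrefl.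
rewrite reflE /z !ldotS side_unit (side_angle T ts) (ordC T t s) chebSS.
by apply/colP => i; rewrite !mxE; ring.
Qed.

(** The Gram bound for n, n', y gives <n, y>^2 >= C^2 - 1, and the one for n,
   y, x gives <x, y>^2 >= 1 + <n, y>^2. *)
Lemma line_dist n n' x y (C : R) : ldot n n = 1 -> ldot n' n' = 1 ->
  ldot n n' = - C -> 1 <= C -> hplane x -> hplane y -> ldot x n = 0 -> ldot y n' = 0 ->
  arccosh C <= hdist x y.
Proof.
move=> nn n'n' nn' C1 hx hy xn yn'; apply: ler_arccosh => //.
have X1 := hplane_ldot hx hy.
have := gram3_le0 n n' y; have := gram3_le0 n y x.
rewrite nn n'n' nn' (proj1 hx) (proj1 hy) (ldotC n x) xn (ldotC n' y) yn' (ldotC y x).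
move: (ldot n y) (ldot x y) X1 => a b b1 h1 h2.
have : C ^+ 2 <= (- b) ^+ 2 by lra.
by rewrite ler_pXn2r // nnegrE; lra.
Qed.

(** Here - <u, g u> = 1 + 2 (s^2 + t^2 + 2 C s t) with s = <n, u>, t = <n', u>,
   and the Gram bound for n, n', u says s^2 + t^2 + 2 C s t >= C^2 - 1. *)
Lemma reflections_displacement n n' u (C : R) : ldot n n = 1 -> ldot n' n' = 1 ->
  ldot n n' = - C -> 1 <= C -> hplane u ->
  2 * arccosh C <= hdist u (hrefl n *m (hrefl n' *m u)).
Proof.
move=> nn n'n' nn' C1 hu; rewrite arccosh2 //.
have C2 := sqrB1_ge0 C1; apply: ler_arccosh; first by lra.
have := gram3_le0 n n' u; rewrite -hrefl_adj // nn n'n' nn' (proj1 hu).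
rewrite !hrefl1E // !ldotS (proj1 hu) nn' ?(ldotC u n') ?(ldotC u n).
by lra.
Qed.

(** The hyperbolic cosine of the distance from the line z to the mirror image
   of the line t in the line s. *)
Definition triple s t (z : 'I_3) : R := c_ t z + 2 * c_ s t * c_ s z.

(** Replacing a4 by its mirror image b in the line s changes no distance to a1
   and a3, so that the polygon consists of two paths from a2 to b. *)
Lemma quad_len s t (z : 'I_3) a1 a2 a3 a4 : s != t -> s != z -> t != z -> 1 <= triple s t z ->
  hplane a1 -> hplane a2 -> hplane a3 -> hplane a4 ->
  ldot a1 (n_ s) = 0 -> ldot a2 (n_ t) = 0 -> ldot a3 (n_ s) = 0 -> ldot a4 (n_ z) = 0 ->
  2 * arccosh (triple s t z) <= hdist a1 a2 + hdist a2 a3 + hdist a3 a4 + hdist a4 a1.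
Proof.
move=> st sz tz C1 h1 h2 h3 h4 e1 e2 e3 e4.
have fix_s x : ldot x (n_ s) = 0 -> refl s *m x = x.
  by move=> xs; rewrite /refl hrefl_fix ?side_unit // ldotC.
set b := refl s *m a4; have hb : hplane b by apply: hrefl_hplane; rewrite ?side_unit.
have d x : ldot x (n_ s) = 0 -> hdist x a4 = hdist x b.
  by move=> /fix_s xs; rewrite -{2}xs hdist_hrefl ?side_unit.
have l : arccosh (triple s t z) <= hdist a2 b.
  apply: (@line_dist (n_ t) (refl s *m n_ z)) => //; rewrite ?side_unit //.
  - by rewrite hrefl_isom ?side_unit.
  - rewrite reflE !ldotS (side_angle T tz) (side_angle T sz) (ldotC (n_ t)) (side_angle T st).
    by rewrite /triple /cosine; ring.
  - by rewrite hrefl_isom ?side_unit.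
have t1 := hdist_triangle h2 h3 hb; have t2 := hdist_triangle h2 h1 hb.
rewrite (hdistC a4 a1) (hdistC a1 a2) !d //.
by move: l t1 t2; rewrite (hdistC a2 a1); lra.
Qed.

Lemma polygon_len s t (z : 'I_3) x l ps : s != t -> s != z -> t != z -> 1 <= triple s t z ->
  l \in [:: [:: s; t; s; z]; [:: t; s; z; s]] ->
  hplane x -> on_sides T ps -> subseq l (map fst ps) ->
  2 * arccosh (triple s t z) <= path_len x ps x.
Proof.
move=> st sz tz C1 hl hx ops /subseqP[m _ em].
apply: le_trans (path_len_mask m hx hx ops).
have sl : size l = 4 by move: hl; rewrite !inE => /orP[] /eqP->.
have := on_sides_mask m ops; rewrite -map_mask in em.
case: (mask m ps) em => [|[i1 p1] [|[i2 p2] [|[i3 p3] [|[i4 p4] [|q5 qs]]]]] /= e; try by rewrite e in sl.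
move=> [h1 e1 [h2 e2 [h3 e3 [h4 e4 _]]]].
have := hdist_triangle h4 hx h1.
move: hl; rewrite e !inE => /orP[] /eqP[E1 E2 E3 E4]; subst.
  by have := quad_len st sz tz C1 h1 h2 h3 h4 e1 e2 e3 e4; lra.
by have := quad_len st sz tz C1 h4 h1 h2 h3 e4 e1 e2 e3; lra.
Qed.

End Cases.

(** * Cosines of submultiples of pi *)
Section Cosines.
Variable R : realType.
Implicit Types m k : nat.

Lemma cheb2 (t : R) : sin t != 0 -> cheb t 2 = 2 * cos t.
Proof. by move=> t0; rewrite chebSS cheb0 cheb1 // mulr1 subr0. Qed.

Lemma cheb3 (t : R) : sin t != 0 -> cheb t 3 = 4 * cos t ^+ 2 - 1.
Proof. by move=> t0; rewrite chebSS cheb2 // cheb1 //; ring. Qed.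

Lemma cos_ge_half m : (3 <= m)%N -> 1 / 2 <= cos (pi / m%:R : R).
Proof.
move=> m3; have m2 : (2 <= m)%N by apply: leq_trans m3.
have s0 := lt0r_neq0 (@sin_piM_gt0 R _ m2).
by have := @cheb_unimodal R m 1 2 m2 isT m3; rewrite cheb1 // cheb2 //; lra.
Qed.

Lemma cos_sqr_ge_half m : (4 <= m)%N -> 1 <= 2 * cos (pi / m%:R : R) ^+ 2.
Proof.
move=> m4; have m2 : (2 <= m)%N by apply: leq_trans m4.
have s0 := lt0r_neq0 (@sin_piM_gt0 R _ m2).
by have := @cheb_unimodal R m 1 3 m2 isT m4; rewrite cheb1 // cheb3 //; lra.
Qed.

Lemma cos_pi5 m : (5 <= m)%N -> 2 * cos (pi / m%:R : R) + 1 <= 4 * cos (pi / m%:R) ^+ 2.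
Proof.
move=> m5; have m2 : (2 <= m)%N by apply: leq_trans m5.
have s0 := lt0r_neq0 (@sin_piM_gt0 R _ m2).
by have := @cheb_unimodal R m 2 3 m2 isT m5; rewrite cheb2 // cheb3 //; lra.
Qed.

Lemma pi_div_itv m : (1 <= m)%N -> pi / m%:R \in `[0, pi : R].
Proof.
move=> m1; rewrite in_itv /= divr_ge0 ?pi_ge0 //=.
by rewrite ler_pdivrMr ?ltr0n // ler_peMr ?pi_ge0 // ler1n.
Qed.

Lemma ltr_cos_pi m k : (1 <= m)%N -> (m < k)%N -> cos (pi / m%:R : R) < cos (pi / k%:R).
Proof.
move=> m1 mk; have k1 : (1 <= k)%N by lia.
rewrite ltr_cos ?pi_div_itv // ltr_pM2l ?pi_gt0 // ltf_pV2 ?posrE ?ltr0n //.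
by rewrite ltr_nat.
Qed.

Lemma ler_cos_pi m k : (1 <= m)%N -> (m <= k)%N -> cos (pi / m%:R : R) <= cos (pi / k%:R).
Proof.
move=> m1; rewrite leq_eqVlt => /orP[/eqP->//|mk].
exact/ltW/ltr_cos_pi.
Qed.

Lemma cos_pi_inj m k : (1 <= m)%N -> (1 <= k)%N ->
  cos (pi / m%:R : R) = cos (pi / k%:R) -> m = k.
Proof.
move=> m1 k1 e; case: (ltngtP m k) => // h.
- by have := ltr_cos_pi m1 h; rewrite e ltxx.
- by have := ltr_cos_pi k1 h; rewrite e ltxx.
Qed.

End Cosines.

Lemma half_index (j m : nat) : (j.+2.*2.+1 <= m)%N ->
  [/\ (5 <= m)%N, (j.+2 + 2 <= m)%N & (0 < j)%N -> (j.+3 + 3 <= m)%N].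
Proof. by rewrite -addnn => h; split; lia. Qed.

(** * Elements shorter than l3 *)
Section Dichotomy.
Variables (R : realType) (T : mirrors R).
Local Notation n_ := (side T).
Local Notation wprod := (wprod T).
Local Notation refl := (refl T).
Local Notation c_ := (cosine T).
Local Notation triple := (triple T).
Implicit Types (k : nat) (i j s t : 'I_3) (w v b d : seq 'I_3) (x y z n : 'cV[R]_3).

Lemma cosineC s t : c_ s t = c_ t s.
Proof. by rewrite /cosine ordC. Qed.

Lemma cosine_half s t : s != t -> 1 / 2 <= c_ s t.
Proof. by move=> st; apply/cos_ge_half/ord_ge3. Qed.

Lemma cosine_le1 s t : c_ s t <= 1.
Proof. exact: cos_le1. Qed.

Lemma triple_ge1 s t u : s != t -> s != u -> t != u -> 1 <= triple s t u.
Proof.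
move=> st su tu; rewrite /triple.
have := cosine_half st; have := cosine_half su; have := cosine_half tu.
move: (c_ s t) (c_ s u) (c_ t u) => a b c c2 b2 a2.
have : 0 <= (a - 1 / 2) * (b - 1 / 2) by apply: mulr_ge0; lra.
by lra.
Qed.

Lemma tripleC s t u : triple s t u = triple s u t.
Proof. by rewrite /triple (cosineC t u); ring. Qed.

(** The vertex opposite to side i lies on the two other sides. *)
Lemma miss_fix b i : i \notin b -> wprod b *m vert T i = vert T i.
Proof.
elim: b => [_|s b IH]; first by rewrite wprod0 mul1mx.
rewrite inE negb_or => /andP[is_ /IH e].
by rewrite wprod_cons_mul e /refl hrefl_fix ?side_unit // ldotC vert_side.
Qed.

Lemma conj_hdist v b x : hdist x (wprod (v ++ b ++ rev v) *m x) =
  hdist (wprod (rev v) *m x) (wprod b *m (wprod (rev v) *m x)).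
Proof.
have e : x = wprod v *m (wprod (rev v) *m x).
  by rewrite mulmxA [_ *m wprod (rev v)]wprodK_rev mul1mx.
by rewrite {1}e !wprod_cat -!mulmxA wprod_hdist.
Qed.

Lemma miss_not_hyperbolic v b i : i \notin b -> ~ hyperbolic (wprod (v ++ b ++ rev v)).
Proof.
move=> ib [u [hu u0 umin]].
have hv : hplane (wprod v *m vert T i) by apply/wprod_hplane/vert_hplane.
have := umin _ hv; rewrite [X in _ <= X]conj_hdist mulmxA [_ *m wprod v]wprod_revK.
rewrite mul1mx miss_fix // hdist_refl; last exact: vert_hplane.
by rewrite leNgt u0.
Qed.

Hypothesis r_le_p : (ord T 1%R 2%R <= ord T 0%R 2%R)%N.
Hypothesis p_le_q : (ord T 0%R 2%R <= ord T 0%R 1%R)%N.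

(** Here c, A, B are the cosines at the three vertices and U, V the coefficients
   of a root at depth three or more in the dihedral group at the vertex c; then
   m >= 5 at this vertex, which is the second hypothesis. *)
Lemma long_root_triple (c A B U V : R) : 1 / 2 <= c -> 2 * c + 1 <= 4 * c ^+ 2 ->
  c <= A -> A <= 1 -> c <= B -> B <= 1 -> 4 * c ^+ 2 - 1 <= U -> 2 * c <= V ->
  c + 2 * A * B <= U * A + V * B.
Proof.
move=> c2 c5 cA A1 cB B1 hU hV.
have h1 : (4 * c ^+ 2 - 1) * A <= U * A by apply: ler_wpM2r; lra.
have h2 : 2 * c * B <= V * B by apply: ler_wpM2r; lra.
have h3 : 0 <= (A - c) * (1 - B) by apply: mulr_ge0; lra.
have h4 : 0 <= (4 * c ^+ 2 - (2 * c + 1)) * A by apply: mulr_ge0; lra.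
have h5 : 0 <= (1 - A) * (1 - c) by apply: mulr_ge0; lra.
have c34 : 3 / 4 <= c by nra.
by lra.
Qed.

(** A point x that is displaced by less than l3 gives a closed billiard polygon
   whose word does not split.  Of the words in word_cases, the ones that miss
   a letter have a fixed point, and in 0 b' the word b' has odd length 2 j + 1,
   so that it is the reflection in an explicit root: j = 0 misses a letter, j = 1
   is special, and j >= 2 gives a displacement of at least l3 everywhere. *)
Lemma dichotomy w : 0 < \det (wprod w) -> hyperbolic (wprod w) ->
  (forall x, hplane x -> 2 * arccosh (triple 0 1 2%R) <= hdist x (wprod w *m x)) \/
  exists v s t, (s, t) \in [:: (1, 2%R); (2%R, 1)] /\
    wprod w = wprod (v ++ [:: 0; s; t; s] ++ rev v).
Proof.
move=> dw hw; apply: contrapT => /not_orP[/existsNP[x /not_implyP[hx /negP]]].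
rewrite -ltNge => short nspec.
have C1 : 1 <= triple 0 1 2%R by apply: triple_ge1.
have [a ca] := covering T hx; set y := wprod a *m x in ca.
have hy : hplane y by apply: wprod_hplane.
have [ps [ops eps lps]] := gallery (a ++ w ++ rev a) hy ca hy ca.
have {}lps : path_len y ps y < 2 * arccosh (triple 0 1 2%R).
  apply: le_lt_trans lps _; rewrite conj_hdist /y mulmxA [_ *m wprod a]wprod_revK.
  by rewrite mul1mx.
have nsp : ~~ splits (map fst ps).
  apply/negP; rewrite /splits => h; move: lps; rewrite ltNge => /negP; apply.
  have p1 l : l \in [:: [:: 0; 1; 0; 2%R]; [:: 1; 0; 2%R; 0]] -> subseq l (map fst ps) ->
      2 * arccosh (triple 0 1 2%R) <= path_len y ps y.
    by move=> hl; apply: (polygon_len _ _ _ _ hl).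
  have p2 l : l \in [:: [:: 0; 2%R; 0; 1]; [:: 2%R; 0; 1; 0]] -> subseq l (map fst ps) ->
      2 * arccosh (triple 0 1 2%R) <= path_len y ps y.
    by rewrite tripleC => hl; apply: (polygon_len _ _ _ _ hl) => //; rewrite tripleC.
  by case/or4P: h; [apply: p1 | apply: p2 | apply: p1 | apply: p2].
have [v [b [eb gb]]] := word_cases T nsp; rewrite eps in eb.
pose V := rev a ++ v.
have ew : wprod w = wprod (V ++ b ++ rev V).
  have : wprod (rev a) * wprod (a ++ w ++ rev a) * wprod a = wprod w.
    by rewrite !wprod_cat !mulrA wprod_revK mul1r -mulrA wprod_revK mulr1.
  by rewrite eb => <-; rewrite /V rev_cat revK !wprod_cat !mulrA.
have nmiss b' i : wprod b' = wprod b -> i \notin b' -> False.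
  move=> e /(@miss_not_hyperbolic V); apply; move: hw.
  by rewrite ew !wprod_cat e.
case: gb => [[i /(nmiss _ _ erefl)//]|[b' eb' nb']].
have ab' : all [in [:: 1; 2%R]] b'.
  apply/allP => i ib'; case: (letter_cases i) => e; rewrite e ?inE //.
  by rewrite e (negPf nb') in ib'.
have ob' : odd (size b').
  have par u : odd (size (u ++ b ++ rev u)) = odd (size b).
    by rewrite !size_cat size_rev !oddD addbCA addbb addbF.
  by move: dw; rewrite ew det_wprod_gt0 par eb' /= negbK.
have [s [t [k [st km eb'']]]] := @dihedral_word _ T 1 2%R b' isT ab'.
have ok : odd k by rewrite -(size_alt s t k) -(wprod_parity eb'').
have ek : k = (k./2).*2.+1 by rewrite -[LHS]odd_double_half ok.
move: (k./2) ek => j ek; rewrite {}ek {k ok} in km eb''.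
have {}eb : wprod b = refl 0 * wprod (alt s t j.*2.+1) by rewrite eb' wprod_cons eb''.
have st' : s != t by move: st; rewrite !inE => /orP[] /eqP[-> ->].
case: j km eb {eb''} => [|[|j]] km eb.
- apply: (nmiss [:: 0; t] s); first by rewrite eb wprod_cons.
  by move: st; rewrite !inE => /orP[] /eqP[-> ->].
- apply: nspec; exists V, t, s; split.
    by move: st; rewrite !inE => /orP[] /eqP[-> ->].
  by rewrite ew (wprod_cat _ V (b ++ _)) (wprod_cat _ b) eb [in RHS]wprod_cat
    [in RHS](wprod_cat _ [:: _; _; _; _]) [in RHS]wprod_cons.
have est : ord T s t = ord T 1 2%R.
  by move: st; rewrite !inE => /orP[] /eqP[-> ->] //; rewrite ordC.
have [r5 j2 j3] : [/\ (5 <= ord T 1%R 2%R)%N, (j.+2 + 2 <= ord T 1%R 2%R)%N &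
    (0 < j)%N -> (j.+3 + 3 <= ord T 1%R 2%R)%N] by apply: half_index.
rewrite (alt_reflection T _ st') in eb.
move: short; rewrite ltNge => /negP; apply.
rewrite ew conj_hdist eb -mulmxA.
set be := _ + _ in eb *.
pose C := cheb (pi / (ord T s t)%:R) j.+3 * c_ 0 t + cheb (pi / (ord T s t)%:R) j.+2 * c_ 0 s.
have s0 : s != 0 by move: st; rewrite !inE => /orP[] /eqP[-> _].
have t0 : t != 0 by move: st; rewrite !inE => /orP[] /eqP[_ ->].
have m2 : (2 <= ord T 1%R 2%R)%N by apply: leq_trans r5.
have sn := lt0r_neq0 (sin_angle T (isT : (1 : 'I_3) != 2%R)).
have U3 : 4 * c_ 1 2%R ^+ 2 - 1 <= cheb (pi / (ord T 1 2%R)%:R) j.+3.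
  rewrite /cosine -cheb3 //; have [->//|/j3 j1] := posnP j.
  exact: (@cheb_unimodal R _ 3 j.+3 m2 isT j1).
have V2 : 2 * c_ 1 2%R <= cheb (pi / (ord T 1 2%R)%:R) j.+2.
  by rewrite /cosine -cheb2 //; exact: (@cheb_unimodal R _ 2 j.+2 m2 isT j2).
have c5 := @cos_pi5 R _ r5; have c2 := cosine_half (isT : (1 : 'I_3) != 2%R).
have cp : c_ 1 2%R <= c_ 0 2%R := ler_cos_pi R (ltnW m2) r_le_p.
have cq : c_ 1 2%R <= c_ 0 1 := ler_cos_pi R (ltnW m2) (leq_trans r_le_p p_le_q).
have C3 : triple 0 1 2%R <= C.
  rewrite /C est /triple; move: st; rewrite !inE => /orP[] /eqP[-> ->].
    rewrite [2 * _ * _]mulrAC; apply: long_root_triple => //; exact: cosine_le1.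
  by apply: long_root_triple => //; exact: cosine_le1.
apply: le_trans (_ : 2 * arccosh C <= _).
  by rewrite ler_pM2l // ler_arccosh.
apply: reflections_displacement; rewrite ?side_unit //; last 2 first.
- exact: le_trans C3.
- exact: wprod_hplane.
- by rewrite /be dihedral_root_unit.
- rewrite /be !ldotS !side_angle ?(eq_sym 0) //; rewrite /C /cosine; ring.
Qed.

End Dichotomy.

(** * Axes of the short translations *)
Section Axes.
Variables (R : realType) (T : mirrors R).
Local Notation n_ := (side T).
Local Notation wprod := (wprod T).
Local Notation refl := (refl T).
Local Notation c_ := (cosine T).
Local Notation triple := (triple T).
Local Notation chamber := (chamber T).
Implicit Types (k : nat) (i j s t r : 'I_3) (w v b d g : seq 'I_3) (x y z n : 'cV[R]_3).

(** The product of the reflections in the line r and in the mirror image of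
   the line t in the line s, a translation by twice arccosh (triple s t r). *)
Definition transl s t r := wprod [:: r; s; t; s].
Definition transl_inv s t r := wprod [:: s; t; s; r].
(** The plane spanned by the normals of the two lines of the translation: its
   trace on the hyperbolic plane is the common perpendicular of the lines. *)
Definition axis s t r x := exists a b : R, x = a *: n_ r + b *: (refl s *m n_ t).

Lemma transl_invrE s t r : (transl s t r)^-1 = transl_inv s t r.
Proof. by rewrite /transl wprod_revE. Qed.

Lemma side_dot s t : s != t -> ldot (n_ s) (n_ t) = - c_ s t.
Proof. exact: side_angle. Qed.

Lemma refl_root s t : s != t -> refl s *m n_ t = n_ t + (2 * c_ s t) *: n_ s.
Proof.
move=> st; rewrite reflE side_dot //.
by apply/colP => i; rewrite !mxE; ring.
Qed.

Lemma root_unit s t : ldot (refl s *m n_ t) (refl s *m n_ t) = 1.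
Proof. by rewrite hrefl_isom side_unit. Qed.

Lemma root_triple s t r : s != t -> s != r -> t != r ->
  ldot (n_ r) (refl s *m n_ t) = - triple s t r.
Proof.
move=> st sr tr; rewrite refl_root // !ldotS (ldotC (n_ r)) side_dot //.
by rewrite (ldotC (n_ r)) side_dot // /triple; ring.
Qed.

Lemma wprod_sts s t x : wprod [:: s; t; s] *m x = hrefl (refl s *m n_ t) *m x.
Proof.
rewrite (_ : wprod [:: s; t; s] = hrefl (wprod [:: s] *m n_ t)) ?wprod1 //.
have := wprod_reflect T [:: s] (side_unit T t); rewrite wprod1 => e.
rewrite !wprod_cons wprod0 mulr1 mulrA -[refl t]/(hrefl (n_ t)) e.
by rewrite -mulrA reflK mulr1.
Qed.

Lemma translE s t r x : transl s t r *m x = hrefl (n_ r) *m (hrefl (refl s *m n_ t) *m x).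
Proof. by rewrite /transl wprod_cons_mul wprod_sts. Qed.

Lemma transl_invE s t r x : transl_inv s t r *m x = hrefl (refl s *m n_ t) *m (hrefl (n_ r) *m x).
Proof.
rewrite -wprod_sts mulmxA; congr (_ *m _).
by rewrite -[hrefl _]/(refl r) -[RHS]/(_ * _) -wprod1 -wprod_cat.
Qed.

Lemma axis_lin s t r (a b : R) x y : axis s t r x -> axis s t r y ->
  axis s t r (a *: x + b *: y).
Proof.
move=> [a1 [b1 ->]] [a2 [b2 ->]]; exists (a * a1 + b * a2), (a * b1 + b * b2).
by apply/colP => i; rewrite !mxE; ring.
Qed.

Lemma axis_side s t r : axis s t r (n_ r).
Proof. by exists 1, 0; rewrite scale1r scale0r addr0. Qed.

Lemma axis_root s t r : axis s t r (refl s *m n_ t).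
Proof. by exists 0, 1; rewrite scale1r scale0r add0r. Qed.

Lemma axis_refl_side s t r x : axis s t r x -> axis s t r (refl r *m x).
Proof.
move=> ax; rewrite reflE -[X in X - _]scale1r -scaleNr; apply: axis_lin => //.
exact: axis_side.
Qed.

Lemma axis_refl_root s t r x : axis s t r x -> axis s t r (hrefl (refl s *m n_ t) *m x).
Proof.
move=> ax; rewrite hrefl1E ?root_unit // -[X in X - _]scale1r -scaleNr; apply: axis_lin => //.
exact: axis_root.
Qed.

(** The operator g + g^-1 - 2 has the axis as its image and acts on it as a
   homothety; as it is symmetric in g and g^-1, conjugating g to another
   translation or to its inverse carries one axis to the other. *)
Definition defect s t r x := transl s t r *m x + transl_inv s t r *m x - 2 *: x.

Lemma defect_axis s t r x : axis s t r (defect s t r x).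
Proof.
have uu := root_unit s t; have nn := side_unit T r.
rewrite /defect translE transl_invE /axis; move: (refl s *m n_ t) (n_ r) uu nn => u n uu nn.
rewrite !hrefl1E // !ldotS.
exists (- (2 * (ldot n x - 2 * ldot u x * ldot n u)) - 2 * ldot n x),
  (- (2 * (ldot u x - 2 * ldot n x * ldot u n)) - 2 * ldot u x).
by apply/colP => i; rewrite !mxE; ring.
Qed.

Lemma defect_scale s t r x : s != t -> s != r -> t != r -> axis s t r x ->
  defect s t r x = (4 * (triple s t r ^+ 2 - 1)) *: x.
Proof.
move=> st sr tr [a [b ->]]; rewrite /defect translE transl_invE.
have := root_triple st sr tr; have := root_unit s t; have := side_unit T r.
move: (refl s *m n_ t) (n_ r) => u n nn uu nu.
rewrite !hrefl1E // !ldotS nn uu (ldotC u) nu.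
by apply/colP => i; rewrite !mxE; ring.
Qed.

Lemma conj_axis w s t r s' t' r' x : s != t -> s != r -> t != r ->
  1 < triple s t r ->
  wprod w * transl s' t' r' * (wprod w)^-1 = transl s t r \/
  wprod w * transl s' t' r' * (wprod w)^-1 = transl_inv s t r ->
  axis s t r x -> axis s' t' r' (wprod (rev w) *m x).
Proof.
move=> st sr tr C1 e ax.
have key : wprod w * (transl s' t' r' + transl_inv s' t' r') * wprod (rev w) = transl s t r + transl_inv s t r.
  have inv : (wprod w * transl s' t' r' * wprod (rev w))^-1 =
      wprod w * transl_inv s' t' r' * wprod (rev w).
    rewrite /transl -!wprod_cat wprod_revE !rev_cat revK wprod_cat wprod_cat.
    by rewrite -catA !wprod_cat.
  rewrite mulrDr mulrDl -inv -wprod_revE.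
  by case: e => ->; rewrite ?transl_invrE // -transl_invrE invrK addrC.
have C0 : 4 * (triple s t r ^+ 2 - 1) != 0.
  by rewrite mulf_neq0 // subr_eq0 gt_eqF // expr_gt1 //; lra.
have -> : wprod (rev w) *m x = (4 * (triple s t r ^+ 2 - 1))^-1 *:
    defect s' t' r' (wprod (rev w) *m x).
  have -> : defect s' t' r' (wprod (rev w) *m x) = wprod (rev w) *m defect s t r x.
    rewrite /defect -!mulmxDl mulmxBr -scalemxAr; congr (_ - _).
    rewrite -key !mulmxA; congr (_ *m _).
    by rewrite [_ *m wprod w]wprod_revK mul1mx.
  by rewrite defect_scale // -scalemxAr scalerA mulVf // scale1r.
rewrite -[X in axis _ _ _ X]addr0 -(scale0r (n_ r')); apply: axis_lin.
  exact: defect_axis.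
exact: axis_side.
Qed.

End Axes.

(** * Elements carrying one axis to another *)
Section Nonconjugacy.
Variables (R : realType) (T : mirrors R).
Local Notation n_ := (side T).
Local Notation wprod := (wprod T).
Local Notation refl := (refl T).
Local Notation c_ := (cosine T).
Local Notation triple := (triple T).
Local Notation chamber := (chamber T).
Local Notation reduced := (reduced T).
Local Notation axis := (axis T).
Local Notation transl := (transl T).
Local Notation transl_inv := (transl_inv T).
Implicit Types (k : nat) (i j s t r : 'I_3) (w v b d g : seq 'I_3) (x y z n : 'cV[R]_3).

(** These conditions ensure that the axis meets the interior of the chamber and
   that its part between the two lines of the translation lies in the chamber
   and its neighbour across side s. *)
Definition generic s t r : Prop :=
  [/\ [/\ s != t, s != r & t != r], 1 <= 2 * c_ t r ^+ 2,
      1 <= 2 * c_ s r ^+ 2 \/ c_ s t < c_ t r &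
      1 <= 2 * c_ s t ^+ 2 \/ c_ s r <= c_ t r].

Lemma three_letters s t r i : s != t -> s != r -> t != r -> [\/ i = s, i = t | i = r].
Proof.
have tot := letter_cases.
by case: (tot s) => ->; case: (tot t) => ->; case: (tot r) => ->; case: (tot i) => -> // _ _ _;
  (exact: Or31 || exact: Or32 || exact: Or33).
Qed.

(** A point n_r al + u of the axis, with u the mirror image of n_t, is interior
   when al lies strictly between two lower bounds, from sides s and t, and the
   upper bound triple s t r, from side r. *)
Lemma axis_interior s t r : generic s t r ->
  exists2 b : 'cV[R]_3, axis s t r b & forall i, ldot b (n_ i) < 0.
Proof.
move=> [[st sr tr] h1 h2 _].
have a2 := cosine_half T st; have b2 := cosine_half T sr; have c2 := cosine_half T tr.
have eab := side_dot T st; have eac := side_dot T sr; have ebc := side_dot T tr.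
pose C := triple s t r.
have lo1 : c_ s t / c_ s r < C.
  rewrite ltr_pdivrMr; last lra.
  rewrite /C /triple; move: (c_ s t) (c_ s r) (c_ t r) a2 b2 c2 h1 h2 {eab eac ebc C}.
  move=> a b c a2 b2 c2 h1 h2.
  have h3 : 1 - 2 * b ^+ 2 <= b.
    have : 0 <= (2 * b - 1) * (b + 1) by apply: mulr_ge0; lra.
    by lra.
  case: h2 => h2.
    have : 0 < c * b by apply: mulr_gt0; lra.
    have : 0 <= a * (2 * b ^+ 2 - 1) by apply: mulr_ge0; lra.
    by lra.
  have : 0 < b * (c - a) by apply: mulr_gt0; lra.
  have : 0 <= a * (b - (1 - 2 * b ^+ 2)) by apply: mulr_ge0; lra.
  by lra.
have lo2 : (1 - 2 * c_ s t ^+ 2) / c_ t r < C.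
  rewrite ltr_pdivrMr; last lra.
  rewrite /C /triple; move: (c_ s t) (c_ s r) (c_ t r) a2 b2 c2 h1 {h2 eab eac ebc C lo1}.
  move=> a b c a2 b2 c2 h1.
  have : 0 <= (a - 1 / 2) * (b - 1 / 2) * c by apply: mulr_ge0; [apply: mulr_ge0 |]; lra.
  have : 0 <= (a - 1 / 2) * c by apply: mulr_ge0; lra.
  have : 0 <= (b - 1 / 2) * c by apply: mulr_ge0; lra.
  have : 0 <= (a - 1 / 2) * (a + 1 / 2) by apply: mulr_ge0; lra.
  by lra.
pose al := (C + Num.max (c_ s t / c_ s r) ((1 - 2 * c_ s t ^+ 2) / c_ t r)) / 2.
have mC : Num.max (c_ s t / c_ s r) ((1 - 2 * c_ s t ^+ 2) / c_ t r) < C.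
  by rewrite gt_max lo1.
have m1 : c_ s t / c_ s r < al.
  have : c_ s t / c_ s r <= Num.max (c_ s t / c_ s r) ((1 - 2 * c_ s t ^+ 2) / c_ t r).
    by rewrite le_max lexx.
  by rewrite /al; lra.
have m2 : (1 - 2 * c_ s t ^+ 2) / c_ t r < al.
  have : (1 - 2 * c_ s t ^+ 2) / c_ t r <= Num.max (c_ s t / c_ s r) ((1 - 2 * c_ s t ^+ 2) / c_ t r).
    by rewrite le_max lexx orbT.
  by rewrite /al; lra.
have m3 : al < C by rewrite /al; lra.
move: m1 m2; rewrite !ltr_pdivrMr; [|lra|lra] => m1 m2.
move: (al) m1 m2 m3 => {al mC lo1 lo2} al m1 m2 m3.
exists (al *: n_ r + 1 *: (refl s *m n_ t)); first by exists al, 1.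
rewrite refl_root //.
move=> i; case: (three_letters i st sr tr) => ->.
- rewrite !ldotS (ldotC (n_ r)) eac (ldotC (n_ t)) eab side_unit; lra.
- rewrite !ldotS (ldotC (n_ r)) ebc eab side_unit; lra.
- by rewrite !ldotS side_unit ebc eac; move: m3; rewrite /C /triple; lra.
Qed.

(** The relations satisfied by the dihedral group generated by the reflections
   in the two lines of the translation: they preserve the axis, and commute
   with the translation or invert it according to their orientation. *)
Definition axial s t r d : Prop :=
  (forall x, axis s t r x -> axis s t r (wprod d *m x)) /\
  wprod d * transl s t r = (if odd (size d) then transl_inv s t r else transl s t r) * wprod d.

Lemma axial0 s t r : axial s t r [::].
Proof. by split=> [x|]; rewrite wprod0 ?mul1mx // mul1r mulr1. Qed.

Lemma transl_split s t r : transl s t r = refl r * wprod [:: s; t; s].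
Proof. exact: wprod_cons. Qed.

Lemma transl_inv_split s t r : transl_inv s t r = wprod [:: s; t; s] * refl r.
Proof. by rewrite /transl_inv -wprod1 -wprod_cat. Qed.

Lemma axial_side s t r d : axial s t r d -> axial s t r (r :: d).
Proof.
move=> [h e]; split=> [x /h|]; first by rewrite wprod_cons_mul; apply: axis_refl_side.
rewrite wprod_cons -mulrA e transl_split transl_inv_split !mulrA /=; congr (_ * _).
case: odd => //=; first by rewrite !mulrA.
by rewrite mulrA reflK mul1r -mulrA reflK mulr1.
Qed.

Lemma axial_root s t r d : axial s t r d -> axial s t r [:: s, t, s & d].
Proof.
move=> [h e]; have ec : wprod [:: s, t, s & d] = wprod [:: s; t; s] * wprod d.
  by rewrite -wprod_cat.
have SS : wprod [:: s; t; s] * wprod [:: s; t; s] = 1 by rewrite -(wprod_revK T [:: s; t; s]).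
split=> [x /h|].
  by rewrite ec -mulmxA wprod_sts; apply: axis_refl_root.
rewrite ec -mulrA e transl_split transl_inv_split !mulrA /= negbK; congr (_ * _).
case: odd => //=; last by rewrite !mulrA.
by rewrite mulrA SS mul1r -mulrA SS mulr1.
Qed.

Lemma generic_triple_gt1 s t r : generic s t r -> 1 < triple s t r.
Proof.
move=> [[st sr tr] h _ _]; rewrite /triple.
have := cosine_half T st; have := cosine_half T sr; have := cosine_half T tr.
move: (c_ s t) (c_ s r) (c_ t r) h => a b c h c2 b2 a2.
have : 0 <= (a - 1 / 2) * (b - 1 / 2) by apply: mulr_ge0; lra.
have : 1 / 2 < c.
  rewrite ltNge; apply/negP => hc; have : 0 <= (1 / 2 - c) * (1 / 2 + c) by apply: mulr_ge0; lra.
  by lra.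
by lra.
Qed.

(** The part of the axis between the two lines of the translation runs through
   the chamber and its neighbour across side s only. *)
Lemma axis_outside s t r x : generic s t r -> axis s t r x ->
  ldot x (n_ r) <= 0 -> ldot x (refl s *m n_ t) <= 0 ->
  chamber x \/ chamber (refl s *m x).
Proof.
move=> gen [a [b ex]]; have [[st sr tr] h1 h2 h3] := gen.
have eab := side_dot T st; have eac := side_dot T sr; have ebc := side_dot T tr.
have xr : ldot x (n_ r) = a - b * triple s t r.
  rewrite ex refl_root // !ldotS side_unit ebc eac /triple; ring.
have xs : ldot x (n_ s) = b * c_ s t - a * c_ s r.
  rewrite ex refl_root // !ldotS side_unit (ldotC (n_ r)) eac (ldotC (n_ t)) eab; ring.
have xt : ldot x (n_ t) = b * (1 - 2 * c_ s t ^+ 2) - a * c_ t r.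
  rewrite ex refl_root // !ldotS side_unit (ldotC (n_ r)) ebc eab; ring.
have xu : ldot x (refl s *m n_ t) = b - a * triple s t r.
  by rewrite refl_root // !ldotS xs xt /triple; ring.
have a2 := cosine_half T st; have b2 := cosine_half T sr; have c2 := cosine_half T tr.
have rs : ldot (refl s *m x) (n_ s) = - ldot x (n_ s) by rewrite ldot_refl_side.
have rt : ldot (refl s *m x) (n_ t) = ldot x (refl s *m n_ t) by rewrite hrefl_adj ?side_unit.
have rr : ldot (refl s *m x) (n_ r) = a * (1 - 2 * c_ s r ^+ 2) - b * c_ t r.
  by rewrite hrefl_adj ?side_unit // refl_root // !ldotS xr xs /triple; ring.
rewrite xr xu => A B.
have ch y : ldot y (n_ s) <= 0 -> ldot y (n_ t) <= 0 -> ldot y (n_ r) <= 0 -> chamber y.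
  by move=> ys yt yr i; case: (three_letters i st sr tr) => ->.
have a0 : 0 <= a /\ 0 <= b.
  have Cgt : 1 < triple s t r by apply: generic_triple_gt1.
  move: (triple s t r) Cgt A B => C C0 A B.
  have pos (u w : R) : u - w * C <= 0 -> w - u * C <= 0 -> 0 <= u.
    move=> h h'; have : 0 <= (u * C - w) * C by apply: mulr_ge0; lra.
    move=> h4; have : 0 <= u * ((C - 1) * (C + 1)) by lra.
    by rewrite pmulr_lge0 //; apply: mulr_gt0; lra.
  by split; [apply: (pos a b) | apply: (pos b a)].
case: a0 => a0 b0.
have aux (c : R) : 1 / 2 <= c -> 1 - 2 * c ^+ 2 <= c.
  move=> hc; have : 0 <= (2 * c - 1) * (c + 1) by apply: mulr_ge0; lra.
  by lra.
have [sneg|spos] := lerP (ldot x (n_ s)) 0; [left | right]; apply: ch.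
- by [].
- rewrite xt; rewrite xs in sneg; have k1 := aux _ a2.
  case: h3 => h3.
    have : 0 <= b * (2 * c_ s t ^+ 2 - 1) by apply: mulr_ge0; lra.
    have : 0 <= a * c_ t r by apply: mulr_ge0; lra.
    by lra.
  have : 0 <= b * (c_ s t - (1 - 2 * c_ s t ^+ 2)) by apply: mulr_ge0; lra.
  have : 0 <= a * (c_ t r - c_ s r) by apply: mulr_ge0; lra.
  by lra.
- by rewrite xr.
- by rewrite rs; lra.
- by rewrite rt xu.
- rewrite rr; rewrite xs in spos; have k1 := aux _ b2.
  case: h2 => h2.
    have : 0 <= a * (2 * c_ s r ^+ 2 - 1) by apply: mulr_ge0; lra.
    have : 0 <= b * c_ t r by apply: mulr_ge0; lra.
    by lra.
  have : 0 <= a * (c_ s r - (1 - 2 * c_ s r ^+ 2)) by apply: mulr_ge0; lra.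
  have : 0 <= b * (c_ t r - c_ s t) by apply: mulr_ge0; lra.
  by lra.
Qed.

(** Choose d axial such that g = d v is as short as possible.  If the point g b
   of the axis were beyond one of the two lines of the translation, reflecting
   it in that line would shorten g: for the line r this is one descent, and for
   the mirror image of t it is a descent along s t s.  So g b lies between the
   two lines, and axis_outside applies. *)
Lemma axis_transport s t r v (b : 'cV[R]_3) : generic s t r -> (forall i, ldot b (n_ i) < 0) ->
  axis s t r (wprod v *m b) ->
  exists d, axial s t r d /\ (wprod d * wprod v = 1 \/ wprod d * wprod v = refl s).
Proof.
move=> gen ib ab; have [[st sr tr] _ _ _] := gen.
have cb : chamber b by move=> i; apply: ltW.
pose P (k : nat) := `[< exists d g, [/\ axial s t r d, reduced g, size g = k &
  wprod g = wprod d * wprod v] >].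
have exP : exists k : nat, P k.
  have [g rg eg] := reduced_exists T v; exists (size g); apply/asboolP; exists [::], g.
  by rewrite wprod0 mul1r; split=> //; apply: axial0.
have [k /asboolP[d [g [ad rg sg eg]]] kmin] := ex_minnP exP.
set y := wprod g *m b.
have ay : axis s t r y by rewrite /y eg -mulmxA; apply: (proj1 ad).
have better d' g' : axial s t r d' -> reduced g' -> wprod g' = wprod d' * wprod v ->
    (size g' < k)%N -> False.
  move=> ad' rg' eg'; apply/negP; rewrite -leqNgt; apply: kmin; apply/asboolP.
  by exists d', g'.
have A : ldot y (n_ r) <= 0.
  rewrite leNgt; apply/negP => /(descent rg cb)[g' [rg' sg' eg']].
  apply: (better (r :: d) g') => //; first exact: axial_side.
    by rewrite eg' eg wprod_cons mulrA.
  by rewrite -sg sg'.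
have B : ldot y (refl s *m n_ t) <= 0.
  rewrite -hrefl_adj ?side_unit // leNgt; apply/negP => yt.
  have [g1 [rg1 eg1 bound]] : exists g1, [/\ reduced g1, wprod g1 = refl s * wprod g &
      forall g2, reduced g2 -> size g1 = (size g2).+1 -> wprod g2 = refl t * wprod g1 ->
      exists g3, [/\ reduced g3, wprod g3 = refl s * wprod g2 & (size g3 < k)%N]].
    have [ys|ys] := ltP 0 (ldot y (n_ s)).
      have [g1 [rg1 sg1 eg1]] := descent rg cb ys.
      exists g1; split=> // g2 rg2 sg2 eg2.
      have [g3 rg3 eg3] := reduced_exists T (s :: g2).
      exists g3; split=> //; first by rewrite eg3 wprod_cons.
      by have /= := rg3 _ (esym eg3); rewrite -sg sg1 sg2.
    have [g1 rg1 eg1] := reduced_exists T (s :: g); rewrite wprod_cons in eg1.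
    exists g1; split=> // g2 rg2 sg2 eg2.
    have pos : 0 < ldot (wprod g2 *m b) (n_ s).
      rewrite eg2 eg1 -!mulmxA -/y hrefl_adj ?side_unit // refl_root ?(eq_sym t) // !ldotS.
      rewrite ldot_refl_side ltr_wpDl ?oppr_ge0 // mulr_gt0 //.
      by have := cosine_half T st; rewrite cosineC; lra.
    have [g3 [rg3 sg3 eg3]] := descent rg2 cb pos.
    exists g3; split=> //; have := rg1 (s :: g); rewrite wprod_cons eg1 => /(_ erefl) /=.
    by rewrite sg2 sg3 sg !ltnS.
  have yt1 : 0 < ldot (wprod g1 *m b) (n_ t) by rewrite eg1 -mulmxA.
  have [g2 [rg2 sg2 eg2]] := descent rg1 cb yt1.
  have [g3 [rg3 eg3 lt3]] := bound _ rg2 sg2 eg2.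
  apply: (better [:: s, t, s & d] g3) => //; first exact: axial_root.
  by rewrite eg3 eg2 eg1 eg !wprod_cons !mulrA.
exists d; split=> //; rewrite -eg.
case: (axis_outside gen ay A B) => cy; [left | right].
  exact: (chamber_interior ib cy).
rewrite /y -wprod_cons_mul in cy.
have := chamber_interior ib cy; rewrite wprod_cons => e.
by rewrite -[wprod g]mul1r -(reflK T s) -mulrA e mulr1.
Qed.

End Nonconjugacy.

(** * Conjugacy of the short translations *)
Section Distinct.
Variables (R : realType) (T : mirrors R).
Local Notation n_ := (side T).
Local Notation wprod := (wprod T).
Local Notation refl := (refl T).
Local Notation c_ := (cosine T).
Local Notation triple := (triple T).
Local Notation axis := (axis T).
Local Notation transl := (transl T).
Local Notation transl_inv := (transl_inv T).
Local Notation generic := (generic T).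
Implicit Types (k : nat) (i j s t r : 'I_3) (w v b d g : seq 'I_3) (x y z n u : 'cV[R]_3).

Lemma vert_side_neq0 i : ldot (vert T i) (n_ i) != 0.
Proof. by rewrite lt_eqF // vert_in. Qed.

(** The vertices read off the coefficients in the basis of the normals. *)
Lemma axis_coord s t r x : s != t -> s != r -> t != r -> axis s t r x ->
  ldot (vert T s) x * ldot (vert T t) (n_ t) =
  2 * c_ s t * ldot (vert T t) x * ldot (vert T s) (n_ s).
Proof.
move=> st sr tr [a [b ->]]; have ts : t != s by rewrite eq_sym.
rewrite refl_root // !ldotS (vert_side T st) (vert_side T sr) (vert_side T tr) (vert_side T ts).
by ring.
Qed.

Lemma axis_swap s t r x : axis s t r (refl s *m x) -> axis s r t x.
Proof.
move=> [a [b e]]; exists b, a.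
rewrite -[LHS](hreflK _ (side_unit T s)) -/(refl s) e mulmxDr -!scalemxAr.
by rewrite hreflK ?side_unit // addrC.
Qed.

Lemma axis_not_sub s t r s' t' r' : s != t -> s != r -> t != r ->
  s' != t' -> s' != r' -> t' != r' -> s != s' -> (4 * c_ s t ^+ 2 != 1) ->
  ~ (forall x, axis s' t' r' x -> axis s t r x).
Proof.
move=> st sr tr st' sr' tr' ss' c4 sub.
have es := vert_side_neq0 s; have et := vert_side_neq0 t.
have ts : t != s by rewrite eq_sym.
have [e|/eqP rs] := eqVneq r' s.
  have := axis_coord st sr tr (sub _ (axis_side _ _ _ _)).
  rewrite e (vert_side T ts) mulr0 mul0r => /eqP.
  by rewrite mulf_eq0 (negPf es) (negPf et).
have ets : t' = s.
  by case: (three_letters s st' sr' tr') ss' rs => -> //; rewrite ?eqxx.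
have := axis_coord st sr tr (sub _ (axis_root _ _ _ _)).
rewrite refl_root // ets !ldotS (vert_side T ts) (vert_side T ss').
have [->|s't] := eqVneq s' t; last first.
  have ts' : t != s' by rewrite eq_sym.
  rewrite (vert_side T ts') !(mulr0, addr0, mul0r) => /eqP.
  by rewrite mulf_eq0 (negPf es) (negPf et).
rewrite (cosineC T t s) => e.
have : (4 * c_ s t ^+ 2 - 1) * (ldot (vert T s) (n_ s) * ldot (vert T t) (n_ t)) = 0 by lra.
move/eqP; rewrite mulf_eq0 mulf_eq0 (negPf es) (negPf et) !orbF subr_eq0.
by rewrite (negPf c4).
Qed.

Lemma transl_neq_inv s t r : s != t -> s != r -> t != r -> 1 < triple s t r ->
  transl s t r <> transl_inv s t r.
Proof.
move=> st sr tr C1 e.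
have := defect_scale st sr tr (axis_side T s t r); rewrite /defect -e => h.
set y := transl s t r *m n_ r in h.
have yE : y = (2 * triple s t r ^+ 2 - 1) *: n_ r.
  apply: (@scalerI _ _ 2) => //.
  move/eqP: h; rewrite subr_eq => /eqP; rewrite -{1 2}[y]scale1r -scalerDl => ->.
  by rewrite -!scalerDl scalerA; congr (_ *: _); ring.
have : ldot y y = 1 by rewrite wprod_isom side_unit.
rewrite yE !ldotS side_unit.
move: (triple s t r) C1 => C C1 h2.
have C2 : 1 < C ^+ 2 by rewrite expr_gt1 //; lra.
have : 0 < (C ^+ 2 - 1) * C ^+ 2 by apply: mulr_gt0; lra.
by lra.
Qed.

(** By axis_transport, w is axial or the product of the reflection in side s
   and an axial element.  In the first case w is orientation preserving, hence
   commutes with the translation, which is not its own inverse; in the second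
   case the reflection in side s would map the axis to itself. *)
Lemma transl_not_conj_inv s t r w : generic s t r -> ~~ odd (size w) ->
  wprod w * transl s t r * (wprod w)^-1 <> transl_inv s t r.
Proof.
move=> gen ow e; have [[st sr tr] h1 h2 h3] := gen.
have C1 := generic_triple_gt1 gen.
have tra x : axis s t r x -> axis s t r (wprod (rev w) *m x).
  by apply: conj_axis => //; right.
have [b ab ib] := axis_interior gen.
have [d [[dax dcom] [ed|ed]]] := axis_transport gen ib (tra _ ab).
  have edw : wprod d = wprod w.
    by rewrite -[LHS]mulr1 -(wprod_revK T w) mulrA ed mul1r.
  move: dcom; rewrite (wprod_parity edw) (negPf ow) edw => com.
  apply: (transl_neq_inv st sr tr C1); rewrite -e com -mulrA mulrV ?mulr1 //.
  exact: wprod_unit.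
have ar := axis_root T s t r.
have := dax _ (tra _ ar); rewrite mulmxA [_ *m wprod (rev w)]ed => /(axis_coord st sr tr).
rewrite hreflK ?side_unit // (vert_side T st) mul0r => /esym/eqP.
rewrite !mulf_eq0 !(negPf (vert_side_neq0 _)) !orbF pnatr_eq0 /=.
have := cosine_half T st => h /eqP h'; rewrite h' in h.
by clear -h; lra.
Qed.

(** By axis_transport the axes would be equal, up to reflection in side s, but
   they bounce on different sides. *)
Lemma transl_not_conj s t r s' t' r' w : generic s t r -> generic s' t' r' -> s != s' ->
  (forall i j, i != j -> 1 <= 2 * c_ i j ^+ 2) ->
  ~ (wprod w * transl s t r * (wprod w)^-1 = transl s' t' r' \/
     wprod w * transl s t r * (wprod w)^-1 = transl_inv s' t' r').
Proof.
move=> gen gen' ss' c2 e; have [[st sr tr] _ _ _] := gen; have [[st' sr' tr'] _ _ _] := gen'.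
have tra x : axis s' t' r' x -> axis s t r (wprod (rev w) *m x).
  by apply: conj_axis => //; apply: generic_triple_gt1.
have [b ab ib] := axis_interior gen'.
have [d [[dax _] ed]] := axis_transport gen ib (tra _ ab).
have c4 i j : i != j -> 4 * c_ i j ^+ 2 != 1.
  by move=> /c2 h; apply/eqP => h'; clear -h h'; lra.
have {}tra x : axis s' t' r' x -> axis s t r (wprod d * wprod (rev w) *m x).
  by move=> /tra/dax; rewrite mulmxA.
case: ed tra => -> tra.
  apply: (@axis_not_sub s t r s' t' r') => // [|x /tra]; first exact: c4.
  by rewrite mul1mx.
apply: (@axis_not_sub s r t s' t' r') => //; first by rewrite eq_sym.
  exact: c4.
by move=> x /tra; apply: axis_swap.
Qed.

(** * Translation lengths *)
(** A timelike vector points into the future after a change of sign. *)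
Lemma hplane_scale x : ldot x x < 0 -> exists k : R, hplane (k *: x).
Proof.
move=> xx; have x0 : x 0 0 != 0.
  apply/eqP => x0; move: xx; rewrite ldotE x0.
  by have := sqr_ge0 (x 1 0); have := sqr_ge0 (x 2%R 0); lra.
have N0 : 0 < - ldot x x by rewrite oppr_gt0.
have s0 : 0 < Num.sqrt (- ldot x x) by rewrite sqrtr_gt0.
exists (Num.sg (x 0 0) / Num.sqrt (- ldot x x)); split.
  rewrite !ldotS mulrA -expr2 exprMn sqr_sg x0 mul1r exprVn sqr_sqrtr ?ltW //.
  by rewrite invrN mulNr mulVf // lt_eqF.
by rewrite !mxE mulrAC divr_gt0 // -normrEsg normr_gt0.
Qed.

(** By symmetry the midpoint of the common perpendicular is proportional to
   n + n'. *)
Lemma reflections_axis n n' (C : R) : ldot n n = 1 -> ldot n' n' = 1 ->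
  ldot n n' = - C -> 1 < C ->
  exists2 u, hplane u & hdist u (hrefl n *m (hrefl n' *m u)) = 2 * arccosh C.
Proof.
move=> nn n'n' nn' C1.
have [|k hu] := @hplane_scale (n + n').
  by rewrite !ldotS nn n'n' (ldotC n') nn'; lra.
exists (k *: (n + n')) => //; rewrite arccosh2 ?ltW // /hdist; congr arccosh.
rewrite -hrefl_adj // !hrefl1E //.
have := proj1 hu; rewrite !ldotS nn n'n' (ldotC n' n) nn' => e.
have ek : k ^+ 2 * (2 * C - 2) = 1 by lra.
transitivity (k ^+ 2 * (2 * C - 2) * (2 * C ^+ 2 - 1)); last by rewrite ek mul1r.
by ring.
Qed.

Lemma hlength_min (g : 'M[R]_3) u : hplane u ->
  (forall x, hplane x -> hdist u (g *m u) <= hdist x (g *m x)) ->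
  hlength g = hdist u (g *m u).
Proof.
move=> hu umin; apply/eqP; rewrite eq_le; apply/andP; split.
  apply: ge_inf; last by exists u.
  by exists (hdist u (g *m u)) => _ [v hv <-]; apply: umin.
apply: lb_le_inf; first by exists (hdist u (g *m u)), u.
by move=> _ [v hv <-]; apply: umin.
Qed.

Lemma hlength_ge (g : 'M[R]_3) (l : R) :
  (forall x, hplane x -> l <= hdist x (g *m x)) -> l <= hlength g.
Proof.
move=> h; have hv := vert_hplane T 0.
apply: lb_le_inf; first by exists (hdist (vert T 0) (g *m vert T 0)), (vert T 0).
by move=> _ [v hv' <-]; apply: h.
Qed.

Lemma reflections_hyperbolic n n' (C : R) (g : 'M[R]_3) : ldot n n = 1 -> ldot n' n' = 1 ->
  ldot n n' = - C -> 1 < C -> (forall x, g *m x = hrefl n *m (hrefl n' *m x)) ->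
  hyperbolic g /\ hlength g = 2 * arccosh C.
Proof.
move=> nn n'n' nn' C1 ge; have [u hu eu] := reflections_axis nn n'n' nn' C1.
have umin (v : 'cV_3) : hplane v -> hdist u (g *m u) <= hdist v (g *m v).
  by move=> hv; rewrite !ge eu; apply: reflections_displacement => //; apply: ltW.
split; last by rewrite (hlength_min hu umin) ge.
exists u; split=> //; rewrite ge eu mulr_gt0 // -(@arccosh1 R).
exact: ltr_arccosh.
Qed.

Lemma transl_hyperbolic s t r : s != t -> s != r -> t != r -> 1 < triple s t r ->
  hyperbolic (transl s t r) /\ hlength (transl s t r) = 2 * arccosh (triple s t r).
Proof.
move=> st sr tr C1; apply: (reflections_hyperbolic (side_unit T r) (root_unit T s t)) => //.
  exact: root_triple.
by move=> x; rewrite translE.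
Qed.

Lemma transl_inv_hyperbolic s t r : s != t -> s != r -> t != r -> 1 < triple s t r ->
  hyperbolic (transl_inv s t r) /\ hlength (transl_inv s t r) = 2 * arccosh (triple s t r).
Proof.
move=> st sr tr C1; apply: (reflections_hyperbolic (root_unit T s t) (side_unit T r)) => //.
  by rewrite ldotC root_triple.
by move=> x; rewrite transl_invE.
Qed.

Lemma hlength_conj w (g : 'M[R]_3) : hlength (wprod w * g * (wprod w)^-1) = hlength g.
Proof.
rewrite /hlength; congr inf; rewrite wprod_revE; apply/seteqP; split=> _ [x hx <-].
  exists (wprod (rev w) *m x); first exact: wprod_hplane.
  rewrite -(wprod_hdist T w) [wprod w *m (wprod (rev w) *m x)]mulmxA.
  by rewrite [wprod w *m wprod (rev w)]wprodK_rev mul1mx !mulmxA.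
exists (wprod w *m x); first exact: wprod_hplane.
rewrite -!mulmxA [wprod (rev w) *m _]mulmxA [wprod (rev w) *m wprod w]wprod_revK mul1mx.
by rewrite wprod_hdist.
Qed.

End Distinct.

(** * Beginning of a length spectrum *)
Section Counting.

Lemma no_injection (i : nat) (f : nat -> nat) :
  (forall a, (a <= i)%N -> (f a < i)%N) ->
  (forall a b, (a <= i)%N -> (b <= i)%N -> f a = f b -> a = b) -> False.
Proof.
move=> fi finj; pose h (a : 'I_i.+1) : 'I_i := Ordinal (fi a (ltn_ord a)).
have hinj : injective h.
  move=> a b /(congr1 val) /= e; apply: val_inj.
  by apply: finj e; rewrite -ltnS.
by have := leq_card h hinj; rewrite !card_ord ltnn.
Qed.

(** Let k j be the index of the class of E j.  Among k 0, ..., k i one is at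
   least i, whence lam i <= ell i.  Among 0, ..., i one index is none of k 0,
   ..., k (i-1), so that its class is E j with j >= i or is not listed, whence
   ell i <= lam i. *)
Lemma spectrum_start (R : realType) (G : set 'M[R]_3) (lam : nat -> R)
    (N : nat) (E : nat -> 'M[R]_3) (ell : nat -> R) :
  length_spectrum G lam ->
  (forall i, (i <= N)%N -> G (E i) /\ hyperbolic (E i)) ->
  (forall i, (i <= N)%N -> hlength (E i) = ell i) ->
  (forall i j, (i < j)%N -> (j <= N)%N -> conj_class G (E i) <> conj_class G (E j)) ->
  (forall i j, (i <= j)%N -> (j <= N)%N -> ell i <= ell j) ->
  (forall g, G g -> hyperbolic g -> ell N <= hlength g \/
     exists2 i, (i <= N)%N & conj_class G g = conj_class G (E i)) ->
  (forall g, G g -> conj_class G g g) ->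
  forall i, (i <= N)%N -> lam i = ell i.
Proof.
move=> [mono [cls [clsH clsinj clssurj] clslen]] GE lenE neqE ellm others refG i iN.
have {}clsinj a b : cls a = cls b -> a = b by apply: clsinj; rewrite inE.
have [k kE] : exists k : nat -> nat, forall j, (j <= N)%N -> cls (k j) = conj_class G (E j).
  have H j : exists m, (j <= N)%N -> cls m = conj_class G (E j).
    case: (leqP j N) => [jN|]; last by exists 0%N.
    have [|m _ em] := clssurj (conj_class G (E j)); first by exists (E j) => //; apply: GE.
    by exists m.
  by exists (fun j => projT1 (cid (H j))) => j; apply: (projT2 (cid (H j))).
have lamk j : (j <= N)%N -> lam (k j) = ell j.
  by move=> jN; rewrite -lenE //; apply: clslen; rewrite kE //; apply: refG; apply: (proj1 (GE _ jN)).
have kinj a b : (a <= N)%N -> (b <= N)%N -> k a = k b -> a = b.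
  move=> aN bN e; have ee : conj_class G (E a) = conj_class G (E b) by rewrite -!kE // e.
  by case: (ltngtP a b) => // h; [case: (neqE _ _ h bN) | case: (neqE _ _ h aN)].
apply/eqP; rewrite eq_le; apply/andP; split.
  have [j ji ij] : exists2 j, (j <= i)%N & (i <= k j)%N.
    apply: contrapT => H; apply: (@no_injection i k) => [a ai|a b ai bi].
      by rewrite ltnNge; apply/negP => h; apply: H; exists a.
    by apply: kinj; apply: leq_trans iN.
  apply: le_trans (mono _ _ ij) _; rewrite lamk ?(leq_trans ji iN) //.
  exact: ellm.
have [m mi mk] : exists2 m, (m <= i)%N & forall j, (j < i)%N -> k j <> m.
  apply: contrapT => H.
  have H' m : exists j, (m <= i)%N -> (j < i)%N /\ k j = m.
    case: (leqP m i) => [mi|]; last by exists 0%N.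
    apply: contrapT => H2; apply: H; exists m => // j ji e; apply: H2.
    by exists j.
  apply: (@no_injection i (fun m => projT1 (cid (H' m)))) => [a ai|a b ai bi e].
    by have [] := projT2 (cid (H' a)) ai.
  have [_ <-] := projT2 (cid (H' a)) ai; have [_ <-] := projT2 (cid (H' b)) bi.
  by rewrite e.
apply: le_trans (mono _ _ mi).
have [g [Gg hg] eg] := clsH m I.
have cg : cls m g by rewrite -eg; apply: refG.
rewrite (clslen _ _ cg).
case: (others g Gg hg) => [|[j jN ej]]; first by apply: le_trans; apply: ellm.
have kj : k j = m by apply: clsinj; rewrite kE // -ej eg.
have ij : (i <= j)%N by rewrite leqNgt; apply/negP => ji; apply: (mk _ ji).
by rewrite -(clslen _ _ cg) -kj lamk //; apply: ellm.
Qed.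

End Counting.

(** * Conjugacy classes of the triangle group *)
Section Classes.
Variables (R : realType) (T : mirrors R).
Local Notation n_ := (side T).
Local Notation wprod := (wprod T).
Local Notation refl := (refl T).
Local Notation c_ := (cosine T).
Local Notation triple := (triple T).
Local Notation transl := (transl T).
Local Notation transl_inv := (transl_inv T).
Local Notation generic := (generic T).
Implicit Types (i j s t r : 'I_3) (w v b d : seq 'I_3).

Definition rotations : set 'M[R]_3 := [set g | exists2 w, ~~ odd (size w) & g = wprod w].
Local Notation class := (conj_class rotations).

Lemma rot_transl s t r : rotations (transl s t r).
Proof. by exists [:: r; s; t; s]. Qed.

Lemma rot_transl_inv s t r : rotations (transl_inv s t r).
Proof. by exists [:: s; t; s; r]. Qed.

Lemma class_refl g : class g g.
Proof. by exists 1; [exists [::] => //; rewrite wprod0 | rewrite mul1r invr1 mulr1]. Qed.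

Lemma class_eqP g h : class g = class h -> exists2 w, ~~ odd (size w) &
  wprod w * g * (wprod w)^-1 = h.
Proof.
by move=> e; have := class_refl h; rewrite -e => -[_ [w ow ->] <-]; exists w.
Qed.

Lemma class_conj w g : ~~ odd (size w) -> class (wprod w * g * (wprod w)^-1) = class g.
Proof.
move=> ow; apply/seteqP; split=> _ [_ [v ov ->] <-].
  exists (wprod (v ++ w)); first by exists (v ++ w); rewrite // size_cat oddD (negPf ov).
  by rewrite wprod_cat invrM ?wprod_unit // !mulrA.
exists (wprod (v ++ rev w)).
  by exists (v ++ rev w); rewrite // size_cat size_rev oddD (negPf ov).
rewrite wprod_cat invrM ?wprod_unit // -wprod_revE invrK !mulrA.
by rewrite -(mulrA (wprod v)) mulVr ?wprod_unit // mulr1 -(mulrA _ (wprod w)^-1)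
  mulVr ?wprod_unit // mulr1.
Qed.

(** The reflection in side r conjugates the translation to its inverse, which
   corrects the orientation of v. *)
Lemma special_class v s t r : 
  class (wprod (v ++ [:: r; s; t; s] ++ rev v)) = class (transl s t r) \/
  class (wprod (v ++ [:: r; s; t; s] ++ rev v)) = class (transl_inv s t r).
Proof.
have [ov|ov] := boolP (odd (size v)); [right | left].
  have -> : wprod (v ++ [:: r; s; t; s] ++ rev v) =
      wprod (rcons v r) * transl_inv s t r * (wprod (rcons v r))^-1.
    rewrite wprod_revE rev_rcons wprod_rcons wprod_cons /transl_inv !wprod_cat.
    rewrite -[[:: s; t; s; r]]/(rcons [:: s; t; s] r) wprod_rcons wprod_cons !mulrA.
    by rewrite -(mulrA _ (refl r) (refl r)) reflK mulr1.
  by apply: class_conj; rewrite size_rcons /= negbK.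
have -> : wprod (v ++ [:: r; s; t; s] ++ rev v) = wprod v * transl s t r * (wprod v)^-1.
  by rewrite wprod_revE !wprod_cat mulrA.
exact: class_conj.
Qed.

Lemma transl_inv_class s t r : generic s t r -> class (transl s t r) <> class (transl_inv s t r).
Proof. by move=> gen /class_eqP[w ow]; apply: transl_not_conj_inv. Qed.

Lemma transl_class_neq s t r s' t' r' : generic s t r -> generic s' t' r' -> s != s' ->
  (forall i j, i != j -> 1 <= 2 * c_ i j ^+ 2) ->
  [/\ class (transl s t r) <> class (transl s' t' r'), class (transl s t r) <> class (transl_inv s' t' r'),
    class (transl_inv s t r) <> class (transl s' t' r') & class (transl_inv s t r) <> class (transl_inv s' t' r')].
Proof.
move=> gen gen' ss' c2.
have H w := transl_not_conj (w := w) gen gen' ss' c2.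
have inv w h : wprod w * transl_inv s t r * (wprod w)^-1 = h ->
    wprod w * transl s t r * (wprod w)^-1 = h^-1.
  move=> <-; rewrite -transl_invrE invrM ?unitrMl ?unitrV ?wprod_unit // invrM ?unitrV ?wprod_unit //.
  by rewrite !invrK mulrA.
split=> /class_eqP[w ow e]; apply: (H w).
- by left.
- by right.
- by right; rewrite (inv _ _ e) transl_invrE.
- by left; rewrite (inv _ _ e) -transl_invrE invrK.
Qed.

End Classes.

(** * The spectrum of a triangle *)
Section Spectrum.
Variables (R : realType) (T : mirrors R) (lam : nat -> R).
Local Notation wprod := (wprod T).
Local Notation c_ := (cosine T).
Local Notation triple := (triple T).
Local Notation transl := (transl T).
Local Notation transl_inv := (transl_inv T).
Local Notation generic := (generic T).
Local Notation class := (conj_class (rotations T)).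
Implicit Types (i j s t r : 'I_3) (w v b d : seq 'I_3).

Hypothesis r_le_p : (ord T 1%R 2%R <= ord T 0%R 2%R)%N.
Hypothesis p_le_q : (ord T 0%R 2%R <= ord T 0%R 1%R)%N.
Hypothesis q_ge4 : (4 <= ord T 0%R 1%R)%N.
Hypothesis lamE : length_spectrum (rotations T) lam.

Local Notation cr := (c_ 1 2%R).
Local Notation cp := (c_ 0 2%R).
Local Notation cq := (c_ 0 1).
Local Notation C1 := (2 * cp * cr + cq).
Local Notation C2 := (2 * cq * cr + cp).
Local Notation C3 := (2 * cp * cq + cr).

Lemma triple_210 : triple 2%R 1 0 = C1.
Proof. by rewrite /triple (cosineC T 1 0) (cosineC T 2%R 1) (cosineC T 2%R 0); ring. Qed.
Lemma triple_120 : triple 1 2%R 0 = C2.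
Proof. by rewrite /triple (cosineC T 1 0) (cosineC T 2%R 0); ring. Qed.
Lemma triple_012 : triple 0 1 2%R = C3.
Proof. by rewrite /triple; ring. Qed.

Lemma cosine_order : [/\ 1 / 2 <= cr, cr <= cp, cp <= cq & 1 / 2 < cq].
Proof.
have r1 : (1 <= ord T 1%R 2%R)%N by apply: leq_trans (ord_ge3 T _).
have cr2 : 1 / 2 <= cr by apply: cosine_half.
have crp : cr <= cp by apply: ler_cos_pi.
have cpq : cp <= cq by apply: ler_cos_pi => //; apply: leq_trans r_le_p.
have cq2 : 1 <= 2 * cq ^+ 2 by apply: cos_sqr_ge_half.
split=> //; rewrite ltNge; apply/negP => hc.
have : 0 <= (1 / 2 - cq) * (1 / 2 + cq) by apply: mulr_ge0; lra.
by lra.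
Qed.

Lemma C1_le_C2 : C1 <= C2.
Proof.
have [? ? ? ?] := cosine_order.
have : 0 <= (2 * cr - 1) * (cq - cp) by apply: mulr_ge0; lra.
by lra.
Qed.

Lemma C2_le_C3 : C2 <= C3.
Proof.
have [? ? ? ?] := cosine_order.
have : 0 <= (2 * cq - 1) * (cp - cr) by apply: mulr_ge0; lra.
by lra.
Qed.

Lemma C1_gt1 : 1 < C1.
Proof.
have [? ? ? ?] := cosine_order.
have : 0 <= (cr - 1 / 2) * (cp - 1 / 2) by apply: mulr_ge0; lra.
by lra.
Qed.

(** For p = 3 the assumption q >= 4 keeps the axis off the vertex of sides 0
   and 2. *)
Lemma generic_210 : generic 2%R 1 0.
Proof.
have [? ? ? ?] := cosine_order.
split=> //; rewrite ?(cosineC T 1 0) ?(cosineC T 2%R 1) ?(cosineC T 2%R 0).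
- exact: cos_sqr_ge_half.
- have [p4|p3] := leqP 4 (ord T 0 2%R); first by left; apply: cos_sqr_ge_half.
  right; apply: ltr_cos_pi; first exact: leq_trans (ord_ge3 T _).
  by apply: leq_trans q_ge4; apply: leq_ltn_trans r_le_p p3.
- by right.
Qed.

Lemma short_translations g : rotations T g -> hyperbolic g -> 2 * arccosh C3 <= hlength g \/
  exists s t, (s, t) \in [:: (1, 2%R); (2%R, 1)] /\
    (class g = class (transl s t 0) \/ class g = class (transl_inv s t 0)).
Proof.
move=> [w ow ->] hw.
have dw : 0 < \det (wprod w) by rewrite det_wprod_gt0.
case: (dichotomy r_le_p p_le_q dw hw) => [long|[v [s [t [st ->]]]]].
  by left; rewrite -triple_012; apply: (hlength_ge T).
by right; exists s, t; split=> //; apply: special_class.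
Qed.

(** The braid relation 1 2 1 = 2 1 2. *)
Lemma transl_r3 : (ord T 1%R 2%R = 3)%N -> transl 1 2%R 0 = transl 2%R 1 0 /\ transl_inv 1 2%R 0 = transl_inv 2%R 1 0.
Proof.
move=> r3; have e : wprod [:: 1; 2%R; 1] = wprod [:: 2%R; 1; 2%R].
  have := @braid R T 1 2%R isT; rewrite r3 /= => e.
  by symmetry.
by rewrite !transl_split !transl_inv_split e.
Qed.

Lemma spectrum_r3 : (ord T 1%R 2%R = 3)%N ->
  lam 0%N = 2 * arccosh C1 /\ lam 1%N = 2 * arccosh C1.
Proof.
move=> r3.
have [h1 e1] := @transl_hyperbolic _ T 2%R 1 0 isT isT isT (generic_triple_gt1 generic_210).
have [h1' e1'] := @transl_inv_hyperbolic _ T 2%R 1 0 isT isT isT (generic_triple_gt1 generic_210).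
pose E (i : nat) := nth 1 [:: transl 2%R 1 0; transl_inv 2%R 1 0] i.
have H := @spectrum_start R (rotations T) lam 1%N E (fun=> 2 * arccosh C1) lamE.
suff K : forall i : nat, (i <= 1)%N -> lam i = 2 * arccosh C1 by split; apply: K.
apply: H => //.
- by move=> [|[|//]] _; split=> //; [apply: rot_transl | apply: rot_transl_inv].
- by move=> [|[|//]] _ /=; rewrite ?e1 ?e1' triple_210.
- by move=> [|i] [|[|//]] // _ _; apply: (transl_inv_class generic_210).
- move=> g Gg hg; case: (short_translations Gg hg) => [long|[s [t [st cg]]]].
    left; apply: le_trans long; rewrite ler_pM2l //.
    by apply: ler_arccosh; [exact: ltW C1_gt1 | exact: le_trans C1_le_C2 C2_le_C3].
  right; have [g3 g3'] := transl_r3 r3.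
  have {}cg : class g = class (transl 2%R 1 0) \/ class g = class (transl_inv 2%R 1 0).
    by move: st cg; rewrite !inE => /orP[] /eqP[-> ->]; rewrite ?g3 ?g3'.
  by case: cg => ->; [exists 0%N | exists 1%N].
- by move=> g _; apply: class_refl.
Qed.

Lemma spectrum_r3_p4 : (ord T 1%R 2%R = 3)%N -> (4 <= ord T 0%R 2%R)%N ->
  2 * arccosh C1 < 2 * arccosh C3 /\ lam 2%N = 2 * arccosh C3.
Proof.
move=> r3 p4; have [cr2 crp cpq cq1] := cosine_order; have C1g := C1_gt1.
have cr3 : cr = 1 / 2.
  rewrite /cosine r3; have s0 : sin (pi / 3) != 0 :> R := lt0r_neq0 (@sin_piM_gt0 R 3 isT).
  have := @cheb_sym R 3 1 isT isT; rewrite cheb1 // (_ : (3 - 1)%N = 2%N) // cheb2 //.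
  by lra.
have cp2 : 1 / 2 < cp by rewrite -cr3; apply: ltr_cos_pi; rewrite r3.
have C13 : C1 < C3.
  rewrite cr3.
  have : 0 < (cp - 1 / 2) * (cq - 1 / 2) by apply: mulr_gt0; lra.
  by lra.
have l13 : 2 * arccosh C1 < 2 * arccosh C3 by rewrite ltr_pM2l // ltr_arccosh // ltW.
split=> //.
have C3_gt1 : 1 < C3 by apply: lt_trans C1g C13.
have [h1 e1] := @transl_hyperbolic _ T 2%R 1 0 isT isT isT (generic_triple_gt1 generic_210).
have [h1' e1'] := @transl_inv_hyperbolic _ T 2%R 1 0 isT isT isT (generic_triple_gt1 generic_210).
have [h3 e3] : hyperbolic (transl 0 1 2%R) /\ hlength (transl 0 1 2%R) = 2 * arccosh C3.
  by rewrite -triple_012; apply: transl_hyperbolic => //; rewrite triple_012.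
rewrite triple_210 in e1 e1'.
pose E (i : nat) := nth 1 [:: transl 2%R 1 0; transl_inv 2%R 1 0; transl 0 1 2%R] i.
pose ell (i : nat) := nth 0 [:: 2 * arccosh C1; 2 * arccosh C1; 2 * arccosh C3] i.
have len g h : hlength g != hlength h -> class g <> class h.
  move=> + /class_eqP[w _ e]; rewrite -e hlength_conj eqxx //.
have H := @spectrum_start R (rotations T) lam 2%N E ell lamE.
apply: (H _ _ _ _ _ _ 2%N) => //.
- move=> [|[|[|//]]] _; split=> //; solve [exact: rot_transl | exact: rot_transl_inv].
- by move=> [|[|[|//]]] _ /=.
- move=> [|[|i]] [|[|[|//]]] // _ _ /=.
  + exact: (transl_inv_class generic_210).
  + by apply: len; rewrite e1 e3 lt_eqF.
  + by apply: len; rewrite e1' e3 lt_eqF.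
- by move=> [|[|[|i]]] [|[|[|//]]] // _ _ /=; rewrite ltW.
- move=> g Gg hg; case: (short_translations Gg hg) => [long|[s [t [st cg]]]]; first by left.
  right; have [g3 g3'] := transl_r3 r3.
  have {}cg : class g = class (transl 2%R 1 0) \/ class g = class (transl_inv 2%R 1 0).
    by move: st cg; rewrite !inE => /orP[] /eqP[-> ->]; rewrite ?g3 ?g3'.
  by case: cg => ->; [exists 0%N | exists 1%N].
- by move=> g _; apply: class_refl.
Qed.

Lemma spectrum_r4 : (4 <= ord T 1%R 2%R)%N ->
  [/\ [/\ lam 0%N = 2 * arccosh C1, lam 1%N = 2 * arccosh C1, lam 2%N = 2 * arccosh C2,
      lam 3%N = 2 * arccosh C2 & lam 4%N = 2 * arccosh C3],
    2 * arccosh C1 <= 2 * arccosh C2, 2 * arccosh C2 <= 2 * arccosh C3,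
    (2 * arccosh C1 = 2 * arccosh C2 <-> ord T 0 2%R = ord T 0 1) &
    (2 * arccosh C2 = 2 * arccosh C3 <-> ord T 1 2%R = ord T 0 2%R)].
Proof.
move=> r4.
have p4 := leq_trans r4 r_le_p.
have [cr2 crp cpq cq1] := cosine_order; have C1g := C1_gt1.

have c2 i j : i != j -> 1 <= 2 * c_ i j ^+ 2.
  move=> ij; apply: cos_sqr_ge_half.
  have q := q_ge4; have tot := letter_cases.
  by case: (tot i) ij => ->; case: (tot j) => -> // _; rewrite // ordC.
have gen s t r : s != t -> s != r -> t != r -> generic s t r.
  by move=> st sr tr; split=> //; [exact: c2 | left; exact: c2 | left; exact: c2].
have C2_gt1 : 1 < C2 by apply: lt_le_trans C1g C1_le_C2.
have C3_gt1 : 1 < C3 by apply: lt_le_trans C2_gt1 C2_le_C3.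
have l12 : 2 * arccosh C1 <= 2 * arccosh C2 by rewrite ler_pM2l //; apply: ler_arccosh C1_le_C2; apply: ltW.
have l23 : 2 * arccosh C2 <= 2 * arccosh C3 by rewrite ler_pM2l //; apply: ler_arccosh C2_le_C3; apply: ltW.
have cr1 : 1 / 2 < cr.
  rewrite ltNge; apply/negP => hc; have := c2 1 2%R isT => h.
  have : 0 <= (1 / 2 - cr) * (1 / 2 + cr) by apply: mulr_ge0; lra.
  by lra.
have two0 : (2 : R) != 0 by rewrite pnatr_eq0.
split=> //; last 2 first.
- split=> [/(mulfI two0)/arccosh_inj e|e]; last by rewrite /cosine e.
  have {}e : C1 = C2 by apply: e; apply: ltW.
  have : (2 * cr - 1) * (cq - cp) = 0 by lra.
  move/eqP; rewrite mulf_eq0 => /orP[/eqP h|]; first by exfalso; lra.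
  rewrite subr_eq0 => /eqP h; apply: (@cos_pi_inj R); last by symmetry.
    exact: leq_trans p4.
  exact: leq_trans q_ge4.
- split=> [/(mulfI two0)/arccosh_inj e|e]; last by rewrite /cosine e; congr (2 * arccosh _); ring.
  have {}e : C2 = C3 by apply: e; apply: ltW.
  have : (2 * cq - 1) * (cp - cr) = 0 by lra.
  move/eqP; rewrite mulf_eq0 => /orP[/eqP h|]; first by exfalso; lra.
  rewrite subr_eq0 => /eqP h; apply: (@cos_pi_inj R); last by symmetry.
    exact: leq_trans r4.
  exact: leq_trans p4.
have g1 := gen 2%R 1 0 isT isT isT; have g2 := gen 1 2%R 0 isT isT isT.
have g3 := gen 0 1 2%R isT isT isT.
have [h1 e1] := @transl_hyperbolic _ T 2%R 1 0 isT isT isT (generic_triple_gt1 g1).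
have [h1' e1'] := @transl_inv_hyperbolic _ T 2%R 1 0 isT isT isT (generic_triple_gt1 g1).
have [h2 e2] := @transl_hyperbolic _ T 1 2%R 0 isT isT isT (generic_triple_gt1 g2).
have [h2' e2'] := @transl_inv_hyperbolic _ T 1 2%R 0 isT isT isT (generic_triple_gt1 g2).
have [h3 e3] := @transl_hyperbolic _ T 0 1 2%R isT isT isT (generic_triple_gt1 g3).
rewrite triple_210 in e1 e1'; rewrite triple_120 in e2 e2'; rewrite triple_012 in e3.
have [n1 n2 n3 n4] := transl_class_neq g1 g2 isT c2.
have [m1 _ m3 _] := transl_class_neq g1 g3 isT c2.
have [k1 _ k3 _] := transl_class_neq g2 g3 isT c2.
have d1 := transl_inv_class g1; have d2 := transl_inv_class g2.
pose E (i : nat) := nth 1 [:: transl 2%R 1 0; transl_inv 2%R 1 0; transl 1 2%R 0; transl_inv 1 2%R 0; transl 0 1 2%R] i.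
pose ell (i : nat) := nth 0 [:: 2 * arccosh C1; 2 * arccosh C1; 2 * arccosh C2;
  2 * arccosh C2; 2 * arccosh C3] i.
have K : forall i : nat, (i <= 4)%N -> lam i = ell i; last by split; apply: K.
apply: (@spectrum_start R (rotations T) lam 4%N E ell lamE).
- by move=> [|[|[|[|[|//]]]]] _; split=> //; solve [exact: rot_transl | exact: rot_transl_inv].
- by move=> [|[|[|[|[|//]]]]] _ /=.
- by move=> [|[|[|[|i]]]] [|[|[|[|[|//]]]]] // _ _ /=.
- by move=> [|[|[|[|[|i]]]]] [|[|[|[|[|//]]]]] // _ _ /=; rewrite ?(le_trans l12 l23).
- move=> g Gg hg; case: (short_translations Gg hg) => [long|[s [t [st cg]]]]; first by left.
  right; move: st cg; rewrite !inE => /orP[] /eqP[-> ->] [] ->.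
  + by exists 2%N.
  + by exists 3%N.
  + by exists 0%N.
  + by exists 1%N.
- by move=> g _; apply: class_refl.
Qed.

End Spectrum.

(** * From the triangle to its mirrors *)
Section Triangle.
Variable R : realType.
Implicit Types (a b c n x y z : 'cV[R]_3).

(** The Lorentzian cross product, normal to the line through x and y. *)
Definition cross x y : 'cV[R]_3 :=
  \col_(i < 3) nth 0 [:: x 2%R 0 * y 1 0 - x 1 0 * y 2%R 0;
    x 2%R 0 * y 0 0 - x 0 0 * y 2%R 0; x 0 0 * y 1 0 - x 1 0 * y 0 0] i.

Lemma ldot_cross x y z : ldot (cross x y) z = det3 x y z.
Proof. by rewrite ldotE /det3 !mxE /=; ring. Qed.

Lemma ldot_cross2 x y z n : ldot (cross x y) (cross z n) =
  ldot x n * ldot y z - ldot x z * ldot y n.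
Proof. by rewrite !ldotE !mxE /=; ring. Qed.

Lemma det3_cycle x y z : det3 y z x = det3 x y z.
Proof. by rewrite /det3; ring. Qed.

Lemma det3_repeat x y : det3 x y x = 0 /\ det3 x y y = 0.
Proof. by rewrite /det3; split; ring. Qed.

Lemma det3_nondegenerate a b c x : det3 a b c != 0 ->
  ldot x a = 0 -> ldot x b = 0 -> ldot x c = 0 -> x = 0.
Proof.
move=> D; rewrite !ldotE => xa xb xc.
have z (t : R) : det3 a b c * t = 0 -> t = 0.
  by move/eqP; rewrite mulf_eq0 (negPf D) => /eqP.
apply: cV3P; rewrite mxE; apply: z; rewrite /det3.
- transitivity (- ((- (x 0 0 * a 0 0) + x 1 0 * a 1 0 + x 2%R 0 * a 2%R 0) * (b 1 0 * c 2%R 0 - b 2%R 0 * c 1 0)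
   - (- (x 0 0 * b 0 0) + x 1 0 * b 1 0 + x 2%R 0 * b 2%R 0) * (a 1 0 * c 2%R 0 - a 2%R 0 * c 1 0)
   + (- (x 0 0 * c 0 0) + x 1 0 * c 1 0 + x 2%R 0 * c 2%R 0) * (a 1 0 * b 2%R 0 - a 2%R 0 * b 1 0))).
    by ring.
  by rewrite xa xb xc; ring.
- transitivity (- ((- (x 0 0 * a 0 0) + x 1 0 * a 1 0 + x 2%R 0 * a 2%R 0) * (b 0 0 * c 2%R 0 - b 2%R 0 * c 0 0)
   - (- (x 0 0 * b 0 0) + x 1 0 * b 1 0 + x 2%R 0 * b 2%R 0) * (a 0 0 * c 2%R 0 - a 2%R 0 * c 0 0)
   + (- (x 0 0 * c 0 0) + x 1 0 * c 1 0 + x 2%R 0 * c 2%R 0) * (a 0 0 * b 2%R 0 - a 2%R 0 * b 0 0))).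
    by ring.
  by rewrite xa xb xc; ring.
- transitivity ((- (x 0 0 * a 0 0) + x 1 0 * a 1 0 + x 2%R 0 * a 2%R 0) * (b 0 0 * c 1 0 - b 1 0 * c 0 0)
   - (- (x 0 0 * b 0 0) + x 1 0 * b 1 0 + x 2%R 0 * b 2%R 0) * (a 0 0 * c 1 0 - a 1 0 * c 0 0)
   + (- (x 0 0 * c 0 0) + x 1 0 * c 1 0 + x 2%R 0 * c 2%R 0) * (a 0 0 * b 1 0 - a 1 0 * b 0 0)).
    by ring.
  by rewrite xa xb xc; ring.
Qed.

(** Equality in the Cauchy inequality behind hplane_ldot. *)
Lemma hplane_eq a b : hplane a -> hplane b -> ldot a b = -1 -> a = b.
Proof.
move=> [aa _] [bb _]; move: aa bb; rewrite !ldotE => aa bb ab.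
have e : (a 0 0 - b 0 0) ^+ 2 + (a 1 0 * b 2%R 0 - a 2%R 0 * b 1 0) ^+ 2 = 0.
  have a2 : a 1 0 ^+ 2 + a 2%R 0 ^+ 2 = a 0 0 ^+ 2 - 1 by lra.
  have b2 : b 1 0 ^+ 2 + b 2%R 0 ^+ 2 = b 0 0 ^+ 2 - 1 by lra.
  have p : a 1 0 * b 1 0 + a 2%R 0 * b 2%R 0 = a 0 0 * b 0 0 - 1 by lra.
  transitivity ((a 0 0 - b 0 0) ^+ 2 + ((a 1 0 ^+ 2 + a 2%R 0 ^+ 2) * (b 1 0 ^+ 2 + b 2%R 0 ^+ 2)
     - (a 1 0 * b 1 0 + a 2%R 0 * b 2%R 0) ^+ 2)); first by ring.
  by rewrite a2 b2 p; ring.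
have e0 : (a 0 0 - b 0 0) ^+ 2 = 0.
  have := sqr_ge0 (a 0 0 - b 0 0); have := sqr_ge0 (a 1 0 * b 2%R 0 - a 2%R 0 * b 1 0).
  by lra.
have ab0 : a 0 0 = b 0 0 by apply/eqP; rewrite -subr_eq0 -sqrf_eq0 e0.
have e12 : (a 1 0 - b 1 0) ^+ 2 + (a 2%R 0 - b 2%R 0) ^+ 2 = 0.
  by rewrite ab0 in aa ab; lra.
have e1 : (a 1 0 - b 1 0) ^+ 2 = 0.
  by have := sqr_ge0 (a 1 0 - b 1 0); have := sqr_ge0 (a 2%R 0 - b 2%R 0); lra.
have e2 : (a 2%R 0 - b 2%R 0) ^+ 2 = 0 by lra.
apply: cV3P => //; apply/eqP; rewrite -subr_eq0 -sqrf_eq0; exact/eqP.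
Qed.

Lemma cross_ge0 a b : hplane a -> hplane b -> 0 <= ldot (cross a b) (cross a b).
Proof.
move=> ha hb; rewrite ldot_cross2 (proj1 ha) (proj1 hb) (ldotC b a).
have := hplane_ldot ha hb => h.
have : 0 <= (- ldot a b - 1) * (1 - ldot a b) by apply: mulr_ge0; lra.
by lra.
Qed.

Lemma cross_eq0 a b : hplane a -> hplane b -> ldot (cross a b) (cross a b) = 0 -> a = b.
Proof.
move=> ha hb; rewrite ldot_cross2 (proj1 ha) (proj1 hb) (ldotC b a) => e.
apply: hplane_eq => //; have := hplane_ldot ha hb => h.
have : (ldot a b + 1) * (ldot a b - 1) = 0 by lra.
by move/eqP; rewrite mulf_eq0 => /orP[] /eqP; lra.
Qed.

(** If the determinant vanishes, the line through two different vertices contains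
   the third one; if all vertices are equal, any line through them does. *)
Lemma htriangle_det a b c : htriangle a b c -> det3 a b c != 0.
Proof.
move=> [ha hb hc noline]; apply/eqP => D; apply: noline.
have through x y : hplane x -> hplane y -> 0 < ldot (cross x y) (cross x y) ->
    [/\ spacelike (cross x y), hline (cross x y) x & hline (cross x y) y].
  move=> hx hy pos; have [d1 d2] := det3_repeat x y.
  by split=> //; split=> //; rewrite ldot_cross.
have := cross_ge0 ha hb; rewrite le_eqVlt => /orP[/eqP/esym ab|ab]; last first.
  by have [s1 s2 s3] := through _ _ ha hb ab; exists (cross a b); split=> //; split=> //; rewrite ldot_cross.
have {}ab := cross_eq0 ha hb ab.
have := cross_ge0 hb hc; rewrite le_eqVlt => /orP[/eqP/esym bc|bc]; last first.
  have [s1 s2 s3] := through _ _ hb hc bc; exists (cross b c); split=> //.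
  by rewrite ab.
have {}bc := cross_eq0 hb hc bc.
rewrite ab -bc; have [b2 b0] := hb.
pose n : 'cV[R]_3 := \col_(i < 3) nth 0 [:: b 1 0; b 0 0; 0] i.
have nb : ldot n b = 0 by rewrite ldotE !mxE /=; ring.
have nn : spacelike n.
  rewrite /spacelike ldotE !mxE /=; move: b2; rewrite ldotE => b2.
  by have := sqr_ge0 (b 2%R 0); lra.
by exists n; split.
Qed.

Definition unitv n : 'cV[R]_3 := (Num.sqrt (ldot n n))^-1 *: n.

Lemma unitv_unit n : 0 < ldot n n -> ldot (unitv n) (unitv n) = 1.
Proof.
move=> nn; rewrite /unitv !ldotS mulrA -expr2 exprVn sqr_sqrtr ?ltW //.
by rewrite mulVf // gt_eqF.
Qed.

Lemma cross_gt0 a b c : hplane a -> hplane b -> det3 a b c != 0 ->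
  0 < ldot (cross a b) (cross a b).
Proof.
move=> ha hb D; rewrite lt_neqAle cross_ge0 // andbT eq_sym.
apply/eqP => /(cross_eq0 ha hb) e; move: D; rewrite e.
by have [_ h] := det3_repeat c b; rewrite (det3_cycle c) h eqxx.
Qed.

(** The cross product turns the tangent vectors at a by a right angle, one of
   them with the opposite orientation; the Gram bound is the Cauchy inequality
   that allows to invert the arc cosine. *)
Lemma normals_angle a b c (m : nat) : (1 <= m)%N -> hplane a -> hplane b -> hplane c ->
  det3 a b c != 0 -> hangle a b c = pi / m%:R ->
  ldot (unitv (cross c a)) (unitv (cross a b)) = - cos (pi / m%:R).
Proof.
move=> m1 ha hb hc D <-.
have pb := cross_gt0 ha hb D.
have pc : 0 < ldot (cross c a) (cross c a).
  by apply: (@cross_gt0 _ _ b) => //; rewrite -(det3_cycle c).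
have [[aa bb] cc] := (proj1 ha, proj1 hb, proj1 hc).
have uu : ldot (tangent a b) (tangent a b) = ldot (cross a b) (cross a b).
  by rewrite ldot_cross2 /tangent !ldotS (ldotC b a) aa bb; ring.
have vv : ldot (tangent a c) (tangent a c) = ldot (cross c a) (cross c a).
  by rewrite ldot_cross2 /tangent !ldotS (ldotC c a) aa cc; ring.
have uv : ldot (tangent a b) (tangent a c) = - ldot (cross c a) (cross a b).
  by rewrite ldot_cross2 /tangent !ldotS (ldotC c a) (ldotC b a) (ldotC c b) aa; ring.
rewrite /hangle acosK; first by rewrite uu vv uv /unitv !ldotS invfM; ring.
rewrite uu vv uv; set A := ldot (cross a b) _ in pb uu *; set B := ldot (cross c a) _ in pc vv *.
have sA : 0 < Num.sqrt A by rewrite sqrtr_gt0.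
have sB : 0 < Num.sqrt B by rewrite sqrtr_gt0.
set S := - ldot _ _ in uv *.
have le : S ^+ 2 <= A * B.
  have := gram3_le0 a b c; rewrite /S sqrrN /A /B !ldot_cross2 aa bb cc.
  rewrite (ldotC b a) (ldotC c a) (ldotC c b); lra.
have {le} : `|S| <= Num.sqrt A * Num.sqrt B.
  have sAB : Num.sqrt A * Num.sqrt B = Num.sqrt (A * B) by rewrite sqrtrM // ltW.
  by rewrite sAB -sqrtr_sqr; apply: ler_wsqrtr.
rewrite in_itv /= -ler_norml normrM normfV (ger0_norm (ltW (mulr_gt0 sA sB))).
by rewrite ler_pdivrMr ?mul1r // mulr_gt0.
Qed.

Lemma hrefl_scale n (k : R) : k != 0 -> ldot n n != 0 -> hrefl (k *: n) = hrefl n.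
Proof.
move=> k0 nn; apply: mx_ext => x; rewrite !hreflE !ldotS scalerA; congr (_ - _ *: _).
by field; rewrite k0 nn.
Qed.

Lemma reflections_inE a b c n : det3 a b c != 0 -> hplane a -> hplane b -> ldot n n = 1 ->
  ldot n a = 0 -> ldot n b = 0 -> ldot n c != 0 -> reflections_in a b = [set hrefl n].
Proof.
move=> D ha hb nn na nb nc; apply/seteqP; split=> [g [m [sm [_ ma] [_ mb] ->]]|g ->] /=.
  pose k := ldot m c / ldot n c.
  have em : m = k *: n.
    apply/eqP; rewrite -subr_eq0; apply/eqP; apply: (det3_nondegenerate D).
    - by rewrite !ldotS ma na mulr0 subr0.
    - by rewrite !ldotS mb nb mulr0 subr0.
    - by rewrite !ldotS /k mulfVK // subrr.
  rewrite em hrefl_scale ?nn ?oner_eq0 //.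
  by apply/eqP => k0; move: sm; rewrite /spacelike em k0 scale0r ldotE !mxE !(mul0r, oppr0, addr0) ltxx.
by exists n; split=> //; rewrite /spacelike nn.
Qed.

(** The sum i + j determines the pair of different letters i and j. *)
Definition triangle_ord (r p q : nat) (i j : 'I_3) : nat :=
  if (i + j == 1)%N then q else if (i + j == 2)%N then p else r.

(** The common sign e makes all three normals point away from the opposite
   vertex. *)
Lemma triangle_mirrors a b c (r p q : nat) : (3 <= r)%N -> (3 <= p)%N -> (3 <= q)%N ->
  htriangle a b c -> hangle a b c = pi / r%:R -> hangle b c a = pi / p%:R ->
  hangle c a b = pi / q%:R ->
  exists2 T : mirrors R, ord T = triangle_ord r p q & triangle_group a b c = rotations T.
Proof.
move=> r3 p3 q3 tri hr hp hq; have D := htriangle_det tri; have [ha hb hc _] := tri.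
have Db : det3 b c a != 0 by rewrite det3_cycle.
have Dc : det3 c a b != 0 by rewrite det3_cycle.
pose e := - Num.sg (det3 a b c).
have e2 : e * e = 1 by rewrite /e mulrNN -expr2 sqr_sg D.
pose S x y := e *: unitv (cross x y).
have SS x y : 0 < ldot (cross x y) (cross x y) -> ldot (S x y) (S x y) = 1.
  by move=> h; rewrite /S ldotZl ldotZr unitv_unit // mulr1.
have neg x y z : det3 x y z = det3 a b c -> 0 < ldot (cross x y) (cross x y) ->
    ldot z (S x y) < 0.
  move=> Dx h; rewrite /S /unitv (ldotC z) !ldotS (ldot_cross x y z) Dx /e mulNr oppr_lt0 mulrCA -normrEsg.
  by rewrite mulr_gt0 ?normr_gt0 // invr_gt0 sqrtr_gt0.
have S0 x y : ldot x (S x y) = 0 /\ ldot y (S x y) = 0.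
  have [h1 h2] := det3_repeat x y.
  by rewrite /S /unitv !ldotS (ldotC x) (ldotC y) (ldot_cross x y x) (ldot_cross x y y) h1 h2 !mulr0.
have gab := cross_gt0 ha hb D; have gbc := cross_gt0 hb hc Db; have gca := cross_gt0 hc ha Dc.
have SD x y z : ldot (S x y) (S y z) = ldot (unitv (cross x y)) (unitv (cross y z)).
  by rewrite /S ldotZl ldotZr mulrA e2 mul1r.
have n12 : ldot (S c a) (S a b) = - cos (pi / r%:R).
  by rewrite SD; apply: normals_angle => //; apply: leq_trans r3.
have n20 : ldot (S a b) (S b c) = - cos (pi / p%:R).
  by rewrite SD; apply: normals_angle => //; apply: leq_trans p3.
have n01 : ldot (S b c) (S c a) = - cos (pi / q%:R).
  by rewrite SD; apply: normals_angle => //; apply: leq_trans q3.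
pose sd (i : 'I_3) := nth 0 [:: S b c; S c a; S a b] i.
pose vt (i : 'I_3) := nth 0 [:: a; b; c] i.
have tot := letter_cases.
have m1 i : ldot (sd i) (sd i) = 1 by case: (tot i) => ->; apply: SS.
have m2 i j : i != j -> ldot (sd i) (sd j) = - cos (pi / (triangle_ord r p q i j)%:R).
  by case: (tot i) => ->; case: (tot j) => -> // _; rewrite /sd /triangle_ord /= ?n12 ?n20 ?n01 // ldotC ?n12 ?n20 ?n01.
have m3 i j : triangle_ord r p q i j = triangle_ord r p q j i by rewrite /triangle_ord addnC.
have m4 i j : i != j -> (3 <= triangle_ord r p q i j)%N.
  by move=> _; rewrite /triangle_ord; case: eqP => // _; case: eqP.
have m5 i : hplane (vt i) by case: (tot i) => ->.
have m6 i j : i != j -> ldot (vt i) (sd j) = 0.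
  have [[A1 A2] [B1 B2]] := (S0 a b, S0 b c); have [C1 C2] := S0 c a.
  by case: (tot i) => ->; case: (tot j) => -> // _; rewrite /vt /sd /= ?A1 ?A2 ?B1 ?B2 ?C1 ?C2.
have m7 i : ldot (vt i) (sd i) < 0.
  have n0 := neg b c a (det3_cycle a b c) gbc.
  have n1 := neg c a b (esym (det3_cycle c a b)) gca.
  have n2 := neg a b c erefl gab.
  by case: (tot i) => ->.
pose T := Mirrors m1 m2 m3 m4 m5 m6 m7.
exists T => //.
have Rab : reflections_in a b = [set refl T 2%R].
  by apply: (reflections_inE D) => //; rewrite ?m1 // ldotC ?(m6 0 2%R) ?(m6 1 2%R) // lt_eqF // (m7 2%R).
have Rbc : reflections_in b c = [set refl T 0].
  by apply: (reflections_inE Db) => //; rewrite ?m1 // ldotC ?(m6 1 0) ?(m6 2%R 0) // lt_eqF // (m7 0).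
have Rca : reflections_in c a = [set refl T 1].
  by apply: (reflections_inE Dc) => //; rewrite ?m1 // ldotC ?(m6 2%R 1) ?(m6 0 1) // lt_eqF // (m7 1).
have words g : reflection_group a b c g <-> exists w, g = wprod T w.
  rewrite /reflection_group Rab Rbc Rca; split=> [|[w ->]].
    elim=> [_ [[->|->]|->]||_ _ _ [v ->] _ [w ->]|_ _ [w ->]].
    - by exists [:: 2%R]; rewrite wprod1.
    - by exists [:: 0]; rewrite wprod1.
    - by exists [:: 1]; rewrite wprod1.
    - by exists [::]; rewrite wprod0.
    - by exists (v ++ w); rewrite wprod_cat.
    - by exists (rev w); rewrite wprod_revE.
  elim: w => [|i w IH]; first by rewrite wprod0; apply: generated_1.
  rewrite wprod_cons; apply: generated_mul IH; apply: generated_in.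
  by case: (tot i) => ->; [left; right | right | left; left].
apply/seteqP; split=> [g [/words[w ->]]|_ [w ow ->]].
  by rewrite det_wprod_gt0 => ow; exists w.
by split; [apply/words; exists w | rewrite det_wprod_gt0].
Qed.

End Triangle.

Theorem mainTheorem1 (R : realType) (r p q : nat)
    (a b c : 'cV[R]_3) (lam : nat -> R) :
  (3 <= r)%N -> (r <= p)%N -> (p <= q)%N ->
  r%:R^-1 + p%:R^-1 + q%:R^-1 < 1 :> R ->
  htriangle a b c ->
  hangle a b c = pi / r%:R ->
  hangle b c a = pi / p%:R ->
  hangle c a b = pi / q%:R ->
  length_spectrum (triangle_group a b c) lam ->
  let cr : R := cos (pi / r%:R) in
  let cp : R := cos (pi / p%:R) in
  let cq : R := cos (pi / q%:R) in
  let l1 := 2 * arccosh (2 * cp * cr + cq) in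
  let l2 := 2 * arccosh (2 * cq * cr + cp) in
  let l3 := 2 * arccosh (2 * cp * cq + cr) in
  [/\ (r = 3%N -> p = 3%N -> (4 <= q)%N -> lam 0%N = l1 /\ lam 1%N = l1),
      (r = 3%N -> p = 4%N -> q = 4%N -> lam 0%N = l1 /\ lam 1%N = l1),
      (r = 3%N -> (4 <= p)%N -> (5 <= q)%N ->
        [/\ lam 0%N = l1, lam 1%N = l1, l1 < l3 & lam 2%N = l3]) &
      ((4 <= r)%N ->
        [/\ [/\ lam 0%N = l1, lam 1%N = l1, lam 2%N = l2, lam 3%N = l2 & lam 4%N = l3],
            l1 <= l2, l2 <= l3, (l1 = l2 <-> p = q) & (l2 = l3 <-> r = p)])].
Proof.
move=> r3 rp pq _ tri hr hp hq lamE cr cp cq l1 l2 l3.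
have p3 := leq_trans r3 rp; have q3 := leq_trans p3 pq.
have [T oT eT] := triangle_mirrors r3 p3 q3 tri hr hp hq; rewrite eT in lamE.
have o12 : ord T 1 2%R = r by rewrite oT.
have o02 : ord T 0 2%R = p by rewrite oT.
have o01 : ord T 0 1 = q by rewrite oT.
have rpT : (ord T 1%R 2%R <= ord T 0%R 2%R)%N by rewrite o12 o02.
have pqT : (ord T 0%R 2%R <= ord T 0%R 1%R)%N by rewrite o02 o01.
have q4T : (4 <= q)%N -> (4 <= ord T 0%R 1%R)%N by rewrite o01.
have start (q4 : (4 <= q)%N) := spectrum_r3 rpT pqT (q4T q4) lamE.
have third (q4 : (4 <= q)%N) := spectrum_r3_p4 rpT pqT (q4T q4) lamE.
have fourth (q4 : (4 <= q)%N) := spectrum_r4 rpT pqT (q4T q4) lamE.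
rewrite /cosine o12 o02 o01 in start third fourth.
split.
- by move=> r_3 _ q4; apply: start.
- by move=> r_3 _ q_4; apply: start => //; rewrite q_4.
- move=> r_3 p4 q5; have q4 : (4 <= q)%N by apply: leq_trans q5.
  by have [s1 s2] := start q4 r_3; have [t1 t2] := third q4 r_3 p4; split.
- by move=> r4; apply: fourth => //; apply: leq_trans r4 (leq_trans rp pq).
Qed.
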